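(* Let $X$ be a complex Banach space and let $T\in B(X)$ with $\sigma(T)\subset\overline{\mathbb{D}}$. If there exists $C>0$ such that $\|P(T)\|\le C\|P\|_{\mathcal{B}}$ for each (complex) polynomial $P$, then $T$ is a GFS operator.
   Context: For $f$ holomorphic on the open unit disc $\mathbb{D}$, $$\|f\|_{\mathcal{B}}=\int_0^1\sup_{t\in[0,2\pi)}|f'(ue^{it})|\,du+\sup_{z\in\mathbb{D}}|f(z)|;$$ $\mathcal{B}(\mathbb{D})$ is the Banach algebra of holomorphic $f$ with $\int_0^1\sup_{t}|f'(ue^{it})|\,du<\infty$. Let $T\in B(X)$, $m\ge1$ an integer, $R(\lambda,T)=(\lambda I_X-T)^{-1}$. $T$ has property $(GFS)_m$ if $\sigma(T)\subset\overline{\mathbb{D}}$ and there is $C>0$ such that for all $r>1$, $x\in X$, $x^*\in X^*$, $\int_0^{2\pi}|\langle R(re^{it},T)^{m+1}x,x^*\rangle|\,dt\le\frac{C}{(r+1)(r-1)^m}\|x\|\|x^*\|$. If $\sigma(T)\subset\overline{\mathbb{D}}$, $T$ has $m$-derivative bounded functional calculus if there is $C>0$ with $\|\phi^{(m)}(T)\|\le\frac{C}{(r-1)^m}\sup_{z\in r\mathbb{D}}|\phi(z)|$ for all $r>1$ and all bounded analytic $\phi:r\mathbb{D}\to\mathbb{C}$, where $r\mathbb{D}$ is the open disc of radius $r$ centred at $0$ and $\phi^{(m)}(T)$ is defined by the Riesz–Dunford calculus. For every $m\ge1$, the following are equivalent: $(GFS)_m$; $1$-derivative bounded functional calculus; $m$-derivative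 bounded functional calculus. $T$ is called a GFS operator if it satisfies one (hence all) of these conditions; in particular $T$ is a GFS operator if and only if it has $(GFS)_1$. *)

(* Defs.v *)
From Stdlib Require Import Reals.
From Coquelicot Require Import Coquelicot.

Open Scope R_scope.

(* [real] sends [p_infty] to 0, so this is the supremum only for a nonempty set
   that is bounded above. *)
Definition sup (E : R -> Prop) : R := real (Lub_Rbar E).

(* The point r e^{it}. *)
Definition polar (r t : R) : C := (r * cos t, r * sin t).

(* [f] is total, but only its values on the open unit disc (and, through
   [C_derive], its derivative there) matter: the integral is taken over [0,1)
   as an improper integral at 1, since |f'| need not be bounded on the disc. *)
Definition B_norm (f : C -> C) : R :=
  RInt_gen
    (fun u => sup (fun y =>
       exists t, 0 <= t < 2 * PI /\ y = Cmod (C_derive f (polar u t))))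
    (at_point 0) (at_left 1)
  + sup (fun y => exists z : C, Cmod z < 1 /\ y = Cmod (f z)).

(* The polynomial a_0 + a_1 z + ... + a_n z^n; [a_n] may vanish. *)
Definition poly_eval (n : nat) (a : nat -> C) (z : C) : C :=
  sum_n (fun k => (a k * Cpow z k)%C) n.

Section Operators.

Context {X : CompleteNormedModule C_AbsRing}.

(* Used for Y = X and, for elements of the dual of X, for Y = C. *)
Definition op_norm {Y : NormedModule C_AbsRing} (S : X -> Y) : R :=
  sup (fun y => exists x : X, norm x <= 1 /\ y = norm (S x)).

Definition poly_op (n : nat) (a : nat -> C) (T : X -> X) (x : X) : X :=
  sum_n (fun k => scal (a k) (Nat.iter k T x)) n.

Definition shift (lambda : C) (T : X -> X) (x : X) : X :=
  minus (scal lambda x) (T x).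

(* [is_linear] is Coquelicot's predicate for bounded linear maps. *)
Definition spectrum (T : X -> X) (lambda : C) : Prop :=
  ~ exists S : X -> X, is_linear S /\
      (forall x, S (shift lambda T x) = x) /\
      (forall x, shift lambda T (S x) = x).

Definition spectrum_in_closed_disc (T : X -> X) : Prop :=
  forall lambda : C, spectrum T lambda -> Cmod lambda <= 1.

(* The inverse of lambda I - T, meaningful for lambda outside the spectrum:
   [iota] selects the unique solution y of lambda y - T y = x. *)
Definition resolvent (lambda : C) (T : X -> X) (x : X) : X :=
  iota (fun y => shift lambda T y = x).

Definition GFS_property (m : nat) (T : X -> X) : Prop :=
  spectrum_in_closed_disc T /\
  exists K : R, 0 < K /\
    forall (r : R) (x : X) (phi : X -> C_NormedModule),
      1 < r -> is_linear phi ->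
      RInt (fun t =>
              Cmod (phi (Nat.iter (m + 1) (resolvent (polar r t) T) x)))
           0 (2 * PI)
      <= K / ((r + 1) * (r - 1) ^ m) * norm x * op_norm phi.

(* The properties [GFS_property m], m >= 1, are all equivalent to each other. *)
Definition GFS_operator (T : X -> X) : Prop := GFS_property 1 T.

End Operators.

(* Main.v *)
Require Import Defs.
From Stdlib Require Import Reals Lra Lia FunctionalExtensionality Classical.
From Coquelicot Require Import Coquelicot.

(** The hypothesis applied to z^n gives ‖T^n‖ <= 2K. Fix r > 1 and N with
    r^N >= 4K, and put lam_j = r e^{is} w^j, where w = e^{2 pi i/N}. Since
    lam_j^N = L does not depend on j, the polynomials
    Q_j(z) = (lam_j^N - z^N) / (lam_j - z) satisfy
    Q_j(T)^2 = (L - T^N)^2 R(lam_j, T)^2 with a common factor (L - T^N)^2 that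
    is bounded below by r^{2N}/4. Choosing |e_j| <= 1 so that
    e_j phi(R(lam_j, T)^2 x) = |phi(R(lam_j, T)^2 x)|, the sum of the latter over
    j is therefore at most a multiple of r^{-2N} ‖p‖_B for p = sum_j e_j Q_j^2.
    The discrete Parseval identity on the N-th roots of unity computes
    sum_j |Q_j|^2 and sum_j |Q_j'|^2, and this yields
    ‖p‖_B <= 7 N r^{2N} / ((r+1)(r-1)). Finally, the integral over [0, 2 pi] is
    the integral of the sum over j, for s in [0, 2 pi/N]. *)

(** Integrating e(t) (r e^{it} - z)^{-2} against a unimodular e(t) would give one function of T that
    carries the whole integral, but it is not a polynomial, and the hypothesis speaks of polynomials
    only. Finitely many nodes remove this obstacle without any approximation: lam_j - z divides
    lam_j^N - z^N, so resolvents turn into polynomials once L - T^N is factored out, and r^N >= 4K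
    >= 2‖T^N‖ keeps that factor harmless. The phases e_j are arbitrary, so p can only be estimated
    through absolute values. The exponent 2 makes this affordable: |Q_j^2| and |Q_j Q_j'| are
    controlled by mean squares over the nodes. On |z| = u, up to powers of r and u, these are
    bounded by N r^{2N}/(r-u) and N r^{2N}/(r-u)^3, hence |p'| by N r^{2N}/(r-u)^2, and integrating
    in u leaves a single factor 1/(r-1), the rate required for m = 1. *)

Open Scope R_scope.

(* [ring] does not see through the carriers of Coquelicot's structures. *)
Ltac R_eq := match goal with |- @eq _ ?a ?b => change (@eq R a b) end.
Ltac C_eq := match goal with |- @eq _ ?a ?b => change (@eq C a b) end.

(** * The discrete Parseval identity *)

Lemma polar_mult (r s a b : R) :
  Cmult (polar r a) (polar s b) = polar (r * s) (a + b).
Proof.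
  unfold polar, Cmult; simpl; rewrite cos_plus, sin_plus; f_equal; ring.
Qed.

Lemma Cmod_polar (r t : R) : 0 <= r -> Cmod (polar r t) = r.
Proof.
  intros Hr; unfold Cmod, polar; simpl.
  replace (_ + _) with (r ^ 2 * ((sin t)² + (cos t)²)) by (unfold Rsqr; ring).
  rewrite sin2_cos2, Rmult_1_r.
  now apply sqrt_pow2.
Qed.

Lemma Cpow_polar (r t : R) (k : nat) :
  Cpow (polar r t) k = polar (r ^ k) (INR k * t).
Proof.
  induction k as [|k IH].
  - unfold polar; simpl; rewrite Rmult_0_l, cos_0, sin_0.
    unfold RtoC; f_equal; ring.
  - rewrite S_INR; simpl Cpow; rewrite IH, polar_mult; simpl.
    f_equal; ring.
Qed.

Lemma Cconj_polar (r t : R) : Cconj (polar r t) = polar r (- t).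
Proof.
  unfold Cconj, polar; simpl; rewrite cos_neg, sin_neg; f_equal; ring.
Qed.

Lemma polar_1_period (k : nat) (t : R) :
  polar 1 (t + 2 * INR k * PI) = polar 1 t.
Proof.
  unfold polar; now rewrite cos_period, sin_period.
Qed.

Lemma polar_1_neq_1 (t : R) : 0 < Rabs t < 2 * PI -> polar 1 t <> RtoC 1.
Proof.
  intros Ht E.
  assert (Hc : cos (Rabs t) = 1).
  { apply (f_equal fst) in E; simpl in E.
    unfold Rabs; destruct (Rcase_abs t); [rewrite cos_neg|]; lra. }
  replace (Rabs t) with (2 * (Rabs t / 2)) in Hc by field.
  rewrite cos_2a_sin in Hc.
  assert (0 < sin (Rabs t / 2)) by (apply sin_gt_0; lra).
  nra.
Qed.

Lemma sum_n_RtoC (f : nat -> R) (n : nat) :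
  RtoC (sum_n f n) = sum_n (fun k => RtoC (f k)) n.
Proof.
  induction n as [|n IH]; [now rewrite !sum_O|].
  rewrite !sum_Sn, <- IH; apply RtoC_plus.
Qed.

Lemma sum_n_Cconj (f : nat -> C) (n : nat) :
  Cconj (sum_n f n) = sum_n (fun k => Cconj (f k)) n.
Proof.
  induction n as [|n IH]; [now rewrite !sum_O|].
  rewrite !sum_Sn, <- IH; apply Cplus_conj.
Qed.

Lemma sum_n_single {G : AbelianMonoid} (f : nat -> G) (n k : nat) :
  (k <= n)%nat -> (forall i, (i <= n)%nat -> i <> k -> f i = zero) ->
  sum_n f n = f k.
Proof.
  revert k; induction n as [|n IH]; intros k Hk Hf.
  - rewrite sum_O; f_equal; lia.
  - rewrite sum_Sn.
    destruct (Nat.eq_dec k (S n)) as [->|Hne].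
    + rewrite (sum_n_ext_loc f (fun _ => zero)).
      * replace (sum_n (fun _ : nat => zero) n) with (@zero G).
        -- apply plus_zero_l.
        -- clear; induction n as [|n IH]; [now rewrite sum_O|].
           now rewrite sum_Sn, <- IH, plus_zero_l.
      * intros i Hi; apply Hf; lia.
    + rewrite (IH k), (Hf (S n)); try lia; [apply plus_zero_r|].
      intros i Hi; apply Hf; lia.
Qed.

Lemma geom_sum_polar (t : R) (n : nat) :
  Cmult (Cminus (polar 1 t) 1) (sum_n (fun j => polar 1 (INR j * t)) n)
  = Cminus (polar 1 (INR (S n) * t)) 1.
Proof.
  induction n as [|n IH].
  - rewrite sum_O; simpl; rewrite Rmult_0_l, Rmult_1_l.
    replace (polar 1 0) with (RtoC 1); [ring|].
    unfold polar; rewrite cos_0, sin_0; unfold RtoC; f_equal; ring.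
  - rewrite sum_Sn.
    change (plus ?a ?b) with (Cplus a b).
    rewrite Cmult_plus_distr_l, IH.
    replace (polar 1 (INR (S (S n)) * t))
      with (Cmult (polar 1 t) (polar 1 (INR (S n) * t))); [ring|].
    rewrite polar_mult; f_equal; [ring|rewrite (S_INR (S n)); ring].
Qed.

(** The ratio [polar 1 t] of this geometric sum is an N-th root of unity, N = [S n], and differs
    from 1 because 0 < |k - l| < N; so the factor [polar 1 t - 1] can be cancelled. *)
Lemma root_of_unity_orthogonality (n k l : nat) :
  (k <= n)%nat -> (l <= n)%nat -> k <> l ->
  sum_n (fun j => polar 1 (INR j * (2 * PI * (INR k - INR l) / INR (S n)))) n
  = RtoC 0.
Proof.
  intros Hk Hl Hkl.
  assert (HN : 0 < INR (S n)) by (apply lt_0_INR; lia).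
  set (t := 2 * PI * (INR k - INR l) / INR (S n)).
  pose proof PI_RGT_0 as Hpi.
  assert (Ht : 0 < Rabs t < 2 * PI).
  { replace t with ((2 * PI / INR (S n)) * (INR k - INR l))
      by (unfold t; field; lra).
    rewrite Rabs_mult, (Rabs_pos_eq (2 * PI / INR (S n)));
      [|apply Rlt_le, Rdiv_lt_0_compat; lra].
    assert (Hd : 0 < Rabs (INR k - INR l) < INR (S n)).
    { split.
      - apply Rabs_pos_lt; intros E; apply Hkl, INR_eq; lra.
      - rewrite S_INR; apply le_INR in Hk; apply le_INR in Hl.
        pose proof (pos_INR k); pose proof (pos_INR l).
        apply Rabs_def1; lra. }
    assert (0 < 2 * PI / INR (S n)) by (apply Rdiv_lt_0_compat; lra).
    split; [nra|].
    apply Rlt_le_trans with (2 * PI / INR (S n) * INR (S n)); [nra|].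
    right; field; lra. }
  assert (Hz : Cminus (polar 1 (INR (S n) * t)) 1 = RtoC 0).
  { replace (polar 1 (INR (S n) * t)) with (RtoC 1); [ring|].
    replace (INR (S n) * t) with (2 * PI * INR k - 2 * PI * INR l)
      by (unfold t; field; lra).
    symmetry.
    (* [INR k - INR l] may be negative and [polar_1_period] adds natural multiples of a turn, so [l]
       turns are added before [k] are removed. *)
    rewrite <- (polar_1_period l).
    replace (_ + _) with (0 + 2 * INR k * PI) by ring.
    rewrite polar_1_period.
    unfold polar; rewrite cos_0, sin_0; unfold RtoC; f_equal; ring. }
  rewrite <- geom_sum_polar in Hz.
  destruct (Ceq_dec (sum_n (fun j => polar 1 (INR j * t)) n) 0) as [E|E]; [exact E|].
  exfalso; apply (Cmult_neq_0 (Cminus (polar 1 t) 1) _) in E; [easy|].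
  apply Cminus_eq_contra, polar_1_neq_1, Ht.
Qed.

(** Each square is expanded into a double sum over [k] and [l]; summing over [j] first kills the
    off-diagonal terms by orthogonality and counts each diagonal term [S n] times. *)
Lemma discrete_parseval (n : nat) (c : nat -> C) :
  sum_n (fun j => Cmod (sum_n (fun k =>
    Cmult (c k) (polar 1 (INR j * (2 * PI * INR k / INR (S n))))) n) ^ 2) n
  = INR (S n) * sum_n (fun k => Cmod (c k) ^ 2) n.
Proof.
  assert (HN : INR (S n) <> 0) by (apply not_0_INR; lia).
  apply RtoC_inj; rewrite sum_n_RtoC, RtoC_mult, sum_n_RtoC.
  transitivity (sum_n (fun j => sum_n (fun k => sum_n (fun l =>
    Cmult (Cmult (c k) (Cconj (c l)))
      (polar 1 (INR j * (2 * PI * (INR k - INR l) / INR (S n))))) n) n) n).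
  { apply sum_n_ext; intros j.
    rewrite Cmod2_conj, sum_n_Cconj, <- (sum_n_mult_r (K := C_Ring)).
    apply sum_n_ext; intros k.
    rewrite <- (sum_n_mult_l (K := C_Ring)).
    apply sum_n_ext; intros l.
    change (@mult C_Ring) with Cmult.
    rewrite Cmult_conj, Cconj_polar.
    replace (polar 1 (INR j * (2 * PI * (INR k - INR l) / INR (S n))))
      with (Cmult (polar 1 (INR j * (2 * PI * INR k / INR (S n))))
              (polar 1 (- (INR j * (2 * PI * INR l / INR (S n)))))); [C_eq; ring|].
    rewrite polar_mult; f_equal; [ring|field; exact HN]. }
  rewrite sum_n_switch, <- (sum_n_mult_l (K := C_Ring)).
  apply sum_n_ext_loc; intros k Hk.
  rewrite sum_n_switch.
  rewrite (sum_n_single _ n k Hk).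
  - rewrite (sum_n_ext _ (fun _ => mult (Cmult (c k) (Cconj (c k))) (RtoC 1))).
    + rewrite (sum_n_mult_l (K := C_Ring)), <- sum_n_RtoC, sum_n_const.
      rewrite Cmod2_conj, Rmult_1_r; apply Cmult_comm.
    + intros j; change (@mult C_Ring) with Cmult; f_equal.
      replace (INR j * _) with 0 by (field; exact HN).
      unfold polar; rewrite cos_0, sin_0; unfold RtoC; f_equal; ring.
  - intros l Hl Hkl.
    rewrite (sum_n_mult_l (K := C_Ring)).
    rewrite root_of_unity_orthogonality; auto.
    apply Cmult_0_r.
Qed.

(** * Bounding the norm of B *)

(** A member and an upper bound exclude both infinite values, which [real] would turn into 0. *)
Lemma sup_is_lub (E : R -> Prop) (y b : R) :
  E y -> (forall x, E x -> x <= b) -> is_lub_Rbar E (Finite (sup E)).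
Proof.
  intros Hy Hb; unfold sup.
  destruct (Lub_Rbar_correct E) as [H1 H2].
  pose proof (H1 y Hy) as Hl.
  pose proof (H2 (Finite b) Hb) as Hu.
  destruct (Lub_Rbar E); simpl in *; try easy.
Qed.

Lemma le_sup (E : R -> Prop) (y b : R) :
  E y -> (forall x, E x -> x <= b) -> y <= sup E.
Proof.
  intros Hy Hb; destruct (sup_is_lub E y b Hy Hb) as [H _]; exact (H y Hy).
Qed.

Lemma sup_le (E : R -> Prop) (y b : R) :
  E y -> (forall x, E x -> x <= b) -> sup E <= b.
Proof.
  intros Hy Hb; destruct (sup_is_lub E y b Hy Hb) as [_ H]; exact (H b Hb).
Qed.

(** * Lipschitz functions and their suprema over circles *)

(** The radius 2 leaves room beyond the unit circle, so that suprema over circles are continuous in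
    the radius even at 1. Boundedness is included to make the class stable under products. *)
Definition lipschitz_on_disc (f : C -> C) : Prop :=
  exists L, 0 <= L /\
    (forall z, Cmod z <= 2 -> Cmod (f z) <= L) /\
    (forall z w, Cmod z <= 2 -> Cmod w <= 2 ->
       Cmod (Cminus (f z) (f w)) <= L * Cmod (Cminus z w)).

Lemma lipschitz_on_disc_const (a : C) : lipschitz_on_disc (fun _ => a).
Proof.
  exists (Cmod a); split; [apply Cmod_ge_0|split].
  - intros; lra.
  - intros z w _ _; replace (Cminus a a) with (RtoC 0) by ring.
    rewrite Cmod_0; apply Rmult_le_pos; apply Cmod_ge_0.
Qed.

Lemma lipschitz_on_disc_id : lipschitz_on_disc (fun z => z).
Proof.
  exists 2; split; [lra|split]; [easy|].
  intros z w _ _; pose proof (Cmod_ge_0 (Cminus z w)); lra.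
Qed.

Lemma lipschitz_on_disc_plus (f g : C -> C) :
  lipschitz_on_disc f -> lipschitz_on_disc g ->
  lipschitz_on_disc (fun z => Cplus (f z) (g z)).
Proof.
  intros (L & HL & Hf & Hf') (M & HM & Hg & Hg').
  exists (L + M); split; [lra|split].
  - intros z Hz; eapply Rle_trans; [apply Cmod_triangle|].
    apply Rplus_le_compat; auto.
  - intros z w Hz Hw.
    replace (Cminus _ _) with
      (Cplus (Cminus (f z) (f w)) (Cminus (g z) (g w))) by ring.
    eapply Rle_trans; [apply Cmod_triangle|].
    rewrite Rmult_plus_distr_r; apply Rplus_le_compat; auto.
Qed.

Lemma lipschitz_on_disc_mult (f g : C -> C) :
  lipschitz_on_disc f -> lipschitz_on_disc g ->
  lipschitz_on_disc (fun z => Cmult (f z) (g z)).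
Proof.
  intros (L & HL & Hf & Hf') (M & HM & Hg & Hg').
  exists (2 * (L * M)); split; [nra|split].
  - intros z Hz; rewrite Cmod_mult.
    apply Rle_trans with (L * M); [|nra].
    apply Rmult_le_compat; auto using Cmod_ge_0.
  - intros z w Hz Hw.
    replace (Cminus _ _) with
      (Cplus (Cmult (Cminus (f z) (f w)) (g z))
             (Cmult (f w) (Cminus (g z) (g w)))) by ring.
    eapply Rle_trans; [apply Cmod_triangle|].
    rewrite !Cmod_mult.
    pose proof (Hf' z w Hz Hw); pose proof (Hg' z w Hz Hw).
    pose proof (Hf w Hw); pose proof (Hg z Hz).
    pose proof (Cmod_ge_0 (Cminus z w)).
    apply Rle_trans with
      ((L * Cmod (Cminus z w)) * M + L * (M * Cmod (Cminus z w))); [|lra].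
    apply Rplus_le_compat; apply Rmult_le_compat; auto using Cmod_ge_0.
Qed.

Lemma lipschitz_on_disc_sum_n (f : nat -> C -> C) (n : nat) :
  (forall k, lipschitz_on_disc (f k)) ->
  lipschitz_on_disc (fun z => sum_n (fun k => f k z) n).
Proof.
  intros Hf; induction n as [|n IH].
  - replace (fun z : C => sum_n (fun k => f k z) 0) with (f 0%nat); auto.
    apply functional_extensionality; intros z; now rewrite sum_O.
  - replace (fun z : C => sum_n (fun k => f k z) (S n)) with
      (fun z => Cplus (sum_n (fun k => f k z) n) (f (S n) z)).
    + now apply lipschitz_on_disc_plus.
    + apply functional_extensionality; intros z; now rewrite sum_Sn.
Qed.

Definition circle_sup (q : C -> C) (u : R) : R :=
  sup (fun y => exists t, 0 <= t < 2 * PI /\ y = Cmod (q (polar u t))).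

Lemma Cmod_polar_abs (u t : R) : Cmod (polar u t) = Rabs u.
Proof.
  replace (polar u t) with (Cmult u (polar 1 t)).
  - rewrite Cmod_mult, Cmod_R, Cmod_polar; lra.
  - unfold polar, Cmult, RtoC; simpl; f_equal; ring.
Qed.

Lemma circle_point (q : C -> C) (u : R) :
  exists t, 0 <= t < 2 * PI /\ Cmod (q (polar u 0)) = Cmod (q (polar u t)).
Proof. exists 0; pose proof PI_RGT_0; split; [lra|easy]. Qed.

Lemma circle_sup_le (q : C -> C) (u b : R) :
  (forall t, Cmod (q (polar u t)) <= b) -> circle_sup q u <= b.
Proof.
  intros H; eapply sup_le; [apply circle_point|].
  intros x (t & _ & ->); auto.
Qed.

(** For fixed [t] the map u -> |q(u e^{it})| is Lipschitz with a constant independent of [t], and a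
    supremum of such maps keeps the constant. *)
Lemma circle_sup_lipschitz (q : C -> C) :
  lipschitz_on_disc q ->
  exists L, 0 <= L /\ forall u v, Rabs u <= 2 -> Rabs v <= 2 ->
    Rabs (circle_sup q u - circle_sup q v) <= L * Rabs (u - v).
Proof.
  intros (L & HL & Hb & Hq); exists L; split; [exact HL|].
  assert (H : forall u v, Rabs u <= 2 -> Rabs v <= 2 ->
    circle_sup q u <= circle_sup q v + L * Rabs (u - v)).
  { intros u v Hu Hv; eapply sup_le; [apply circle_point|].
    intros x (t & Ht & ->).
    assert (H1 : Cmod (q (polar v t)) <= circle_sup q v).
    { apply le_sup with L; [now exists t|].
      intros y (s & _ & ->); apply Hb; now rewrite Cmod_polar_abs. }
    assert (H2 : Cmod (Cminus (q (polar u t)) (q (polar v t))) <= L * Rabs (u - v)).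
    { eapply Rle_trans; [apply Hq; now rewrite Cmod_polar_abs|].
      replace (Cminus (polar u t) (polar v t)) with (polar (u - v) t).
      - rewrite Cmod_polar_abs; lra.
      - unfold polar, Cminus, Cplus, Copp; simpl; f_equal; ring. }
    replace (q (polar u t)) with
      (Cplus (q (polar v t)) (Cminus (q (polar u t)) (q (polar v t)))) by ring.
    eapply Rle_trans; [apply Cmod_triangle|lra]. }
  intros u v Hu Hv.
  pose proof (H u v Hu Hv); pose proof (H v u Hv Hu) as H'.
  rewrite (Rabs_minus_sym v u) in H'.
  apply Rabs_le; lra.
Qed.

Lemma continuous_of_local_lipschitz (f : R -> R) (x d L : R) :
  0 < d -> 0 <= L ->
  (forall y, Rabs (y - x) < d -> Rabs (f y - f x) <= L * Rabs (y - x)) ->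
  continuous f x.
Proof.
  intros Hd HL Hf.
  apply filterlim_locally; intros eps.
  assert (He : 0 < Rmin d (eps / (L + 1))).
  { apply Rmin_pos; [exact Hd|].
    apply Rdiv_lt_0_compat; [apply cond_pos|lra]. }
  exists (mkposreal _ He); intros y Hy.
  change (Rabs (y - x) < Rmin d (eps / (L + 1))) in Hy.
  change (Rabs (f y - f x) < eps).
  pose proof (Rmin_l d (eps / (L + 1))); pose proof (Rmin_r d (eps / (L + 1))).
  pose proof (Rabs_pos (y - x)).
  assert (H3 : Rabs (y - x) < eps / (L + 1)) by lra.
  apply (Rmult_lt_compat_r (L + 1)) in H3; [|lra].
  replace (eps / (L + 1) * (L + 1)) with (pos eps) in H3 by (field; lra).
  specialize (Hf y ltac:(lra)); nra.
Qed.

Lemma continuous_circle_sup (q : C -> C) (u : R) :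
  lipschitz_on_disc q -> -1 <= u < 2 -> continuous (circle_sup q) u.
Proof.
  intros Hq Hu.
  destruct (circle_sup_lipschitz q Hq) as (L & HL & H).
  apply continuous_of_local_lipschitz with (Rmin 1 (2 - u)) L; auto.
  - apply Rmin_pos; lra.
  - intros y Hy.
    pose proof (Rmin_l 1 (2 - u)); pose proof (Rmin_r 1 (2 - u)).
    apply Rabs_lt_between' in Hy.
    apply H; apply Rabs_le; lra.
Qed.

(** Continuity of [f] slightly beyond [b] makes the primitive continuous at [b], so the improper
    integral of [B_norm] is an ordinary one. *)
Lemma is_RInt_gen_at_left (f : R -> R) (a b d : R) :
  0 < d -> a < b ->
  (forall x, a <= x < b + d -> continuous f x) ->
  is_RInt_gen f (at_point a) (at_left b) (RInt f a b).
Proof.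
  intros Hd Hab Hf.
  assert (Hex : forall y, Rabs (y - b) < Rmin d (b - a) -> is_RInt f a y (RInt f a y)).
  { intros y Hy; apply (RInt_correct f a y), (ex_RInt_continuous f).
    pose proof (Rmin_l d (b - a)); pose proof (Rmin_r d (b - a)).
    apply Rabs_lt_between' in Hy.
    intros z; rewrite Rmin_left, Rmax_right; try lra.
    intros Hz; apply Hf; lra. }
  assert (Hd' : 0 < Rmin d (b - a)) by (apply Rmin_pos; lra).
  assert (Hloc : locally b (fun y => is_RInt f a y (RInt f a y))).
  { exists (mkposreal _ Hd'); intros y Hy; apply Hex, Hy. }
  pose proof (continuous_RInt_1 f a b (RInt f a) Hloc) as Hc.
  intros P HP.
  pose proof (filter_and _ _ Hloc (Hc P HP)) as HQ.
  exists (fun x => x = a)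
    (fun y => is_RInt f a y (RInt f a y) /\ P (RInt f a y)); [easy| |].
  - unfold at_left, within; revert HQ; apply filter_imp; intros y HQ _; exact HQ.
  - intros x y -> [H1 H2]; exists (RInt f a y); auto.
Qed.

(** The regularity of [q] makes the integrand of [B_norm] continuous on [0, 1], so that it can be
    compared with an explicit radial majorant [G] whose integral is known. *)
Lemma B_norm_le (p q : C -> C) (G : R -> R) (I b : R) :
  (forall z : C, is_derive (V := C_NormedModule) p z (q z)) ->
  lipschitz_on_disc q ->
  (forall u t, 0 <= u <= 1 -> Cmod (q (polar u t)) <= G u) ->
  is_RInt G 0 1 I ->
  (forall z, Cmod z < 1 -> Cmod (p z) <= b) ->
  B_norm p <= I + b.
Proof.
  intros Hd Hq HG HI Hb.
  unfold B_norm; apply Rplus_le_compat.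
  - replace (fun u => sup _) with (circle_sup q).
    + rewrite (is_RInt_gen_unique _ (RInt (circle_sup q) 0 1)).
      * rewrite <- (is_RInt_unique G 0 1 I HI).
        apply RInt_le; [lra| |now exists I|].
        -- apply (ex_RInt_continuous (circle_sup q)).
           rewrite Rmin_left, Rmax_right by lra.
           intros z Hz; apply continuous_circle_sup; auto; lra.
        -- intros u Hu; apply circle_sup_le; intros t; apply HG; lra.
      * apply is_RInt_gen_at_left with 1; try lra.
        intros x Hx; apply continuous_circle_sup; auto; lra.
    + apply functional_extensionality; intros u; unfold circle_sup; f_equal.
      apply functional_extensionality; intros y.
      replace (C_derive p) with q; [easy|].
      apply functional_extensionality; intros z; symmetry.
      apply is_C_derive_unique, Hd.
  - eapply sup_le.
    + exists (RtoC 0); split; [rewrite Cmod_0; lra|easy].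
    + intros y (z & Hz & ->); auto.
Qed.

(** * Powers of geometric sums *)

Lemma sum_n_Rle (f g : nat -> R) (n : nat) :
  (forall k, f k <= g k) -> sum_n f n <= sum_n g n.
Proof.
  intros H; induction n as [|n IH]; [rewrite !sum_O; auto|].
  rewrite !sum_Sn; apply Rplus_le_compat; auto.
Qed.

Lemma sum_n_ge_0 (f : nat -> R) (n : nat) : (forall k, 0 <= f k) -> 0 <= sum_n f n.
Proof.
  intros Hf; induction n as [|n IH]; [rewrite sum_O; apply Hf|].
  rewrite sum_Sn; now apply Rplus_le_le_0_compat.
Qed.

Lemma Cmod_sum_n_le (f : nat -> C) (n : nat) :
  Cmod (sum_n f n) <= sum_n (fun k => Cmod (f k)) n.
Proof.
  induction n as [|n IH]; [rewrite !sum_O; lra|].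
  rewrite !sum_Sn; eapply Rle_trans; [apply Cmod_triangle|].
  apply Rplus_le_compat; auto; lra.
Qed.

(** With the last term split off, the second factor is shifted by one; a relation between
    consecutive values of [g] thus becomes a recursion in [n] for the convolution. *)
Lemma sum_n_conv_S {K : Ring} (f g : nat -> K) (n : nat) :
  sum_n (fun k => mult (f k) (g (S n - k)%nat)) (S n)
  = plus (sum_n (fun k => mult (f k) (g (S (n - k)))) n) (mult (f (S n)) (g 0%nat)).
Proof.
  rewrite sum_Sn, Nat.sub_diag; f_equal.
  apply sum_n_ext_loc; intros k Hk; now rewrite Nat.sub_succ_l.
Qed.

(** * Weighted convolutions of two geometric sequences *)

Section WeightedGeometricSums.

Context (a b : R) (hb : 0 <= b) (hab : b < a).

Let S0 (n : nat) := sum_n (fun k => a ^ k * b ^ (n - k)) n.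
(** For a = r^2 and b = |z|^2, [S0] and [S2] are the coefficient sums that Parseval yields for Q and
    Q'. [S1] links them: its weights 2m + 1 are the differences of consecutive squares. *)
Let S1 (n : nat) := sum_n (fun k => a ^ k * ((2 * INR (n - k) + 1) * b ^ (n - k))) n.
Let S2 (n : nat) := sum_n (fun k => a ^ k * (INR (n - k) ^ 2 * b ^ pred (n - k))) n.

Lemma weighted_sum0_S (n : nat) : S0 (S n) = b * S0 n + a ^ S n.
Proof.
  unfold S0.
  rewrite (sum_n_conv_S (K := R_Ring) (fun k => a ^ k) (fun m => b ^ m)).
  rewrite <- (sum_n_mult_l (K := R_Ring)).
  change (@plus R_Ring) with Rplus; change (@mult R_Ring) with Rmult.
  f_equal; [|simpl; ring].
  apply sum_n_ext; intros k; simpl; R_eq; ring.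
Qed.

Lemma weighted_sum1_S (n : nat) : S1 (S n) = b * S1 n + 2 * b * S0 n + a ^ S n.
Proof.
  unfold S1, S0.
  rewrite (sum_n_conv_S (K := R_Ring) (fun k => a ^ k)
             (fun m => (2 * INR m + 1) * b ^ m)).
  rewrite <- !(sum_n_mult_l (K := R_Ring)).
  change (@plus R_Ring) with Rplus; change (@mult R_Ring) with Rmult.
  rewrite <- (sum_n_plus (G := R_AbelianMonoid)).
  change (@plus R_AbelianMonoid) with Rplus.
  f_equal; [|simpl; ring].
  apply sum_n_ext; intros k; rewrite S_INR; simpl; R_eq; ring.
Qed.

Lemma weighted_sum2_S (n : nat) : S2 (S n) = b * S2 n + S1 n.
Proof.
  unfold S2, S1.
  rewrite (sum_n_conv_S (K := R_Ring) (fun k => a ^ k)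
             (fun m => INR m ^ 2 * b ^ pred m)).
  rewrite <- !(sum_n_mult_l (K := R_Ring)).
  change (@plus R_Ring) with Rplus; change (@mult R_Ring) with Rmult.
  rewrite <- (sum_n_plus (G := R_AbelianMonoid)).
  change (@plus R_AbelianMonoid) with Rplus.
  replace (a ^ S n * (INR 0 ^ 2 * b ^ pred 0)) with 0 by (simpl; ring).
  rewrite Rplus_0_r.
  apply sum_n_ext; intros k; destruct (n - k)%nat as [|m]; [simpl; R_eq; ring|].
  rewrite (S_INR (S m)); simpl pred; simpl (b ^ S m); R_eq; ring.
Qed.

Lemma weighted_sum0_le (n : nat) : (a - b) * S0 n <= a ^ S n.
Proof.
  assert (E : (a - b) * S0 n = a ^ S n - b ^ S n).
  { induction n as [|n IH].
    - unfold S0; rewrite sum_O; simpl; ring.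
    - rewrite weighted_sum0_S.
      replace (_ * _) with (b * ((a - b) * S0 n) + (a - b) * a ^ S n) by ring.
      rewrite IH; simpl; ring. }
  pose proof (pow_le b (S n) hb); lra.
Qed.

(** With x = b/a, the bounds on [S1] and [S2] come from the full series: sum (2m+1) x^m =
    (1+x)/(1-x)^2 and sum m^2 x^(m-1) = (1+x)/(1-x)^3. The right-hand sides reproduce themselves
    exactly under the recursions. *)
Lemma weighted_sum1_le (n : nat) : (a - b) ^ 2 * S1 n <= (a + b) * a ^ S n.
Proof.
  induction n as [|n IH].
  - unfold S1; rewrite sum_O; simpl.
    assert (0 <= b * (3 * a - b)) by (apply Rmult_le_pos; lra); lra.
  - rewrite weighted_sum1_S; pose proof (weighted_sum0_le n) as H0.
    simpl (a ^ S (S n)).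
    apply (Rmult_le_compat_l b) in IH; [|exact hb].
    apply (Rmult_le_compat_l (2 * b * (a - b))) in H0; [|nra].
    change (a * (a * a ^ n)) with (a * a ^ S n).
    lra.
Qed.

Lemma weighted_sum2_le (n : nat) : (a - b) ^ 3 * S2 n <= (a + b) * a ^ S n.
Proof.
  induction n as [|n IH].
  - unfold S2; rewrite sum_O; simpl; nra.
  - rewrite weighted_sum2_S; pose proof (weighted_sum1_le n) as H1.
    change (a ^ S (S n)) with (a * a ^ S n).
    apply (Rmult_le_compat_l b) in IH; [|exact hb].
    apply (Rmult_le_compat_l (a - b)) in H1; [|lra].
    lra.
Qed.

End WeightedGeometricSums.

(* [(lam ^ (n + 1) - z ^ (n + 1)) / (lam - z)] *)
Fixpoint geom (lam : C) (n : nat) (z : C) : C :=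
  match n with
  | O => RtoC 1
  | S m => Cplus (Cmult z (geom lam m z)) (Cpow lam n)
  end.

Fixpoint geom' (lam : C) (n : nat) (z : C) : C :=
  match n with
  | O => RtoC 0
  | S m => Cplus (geom lam m z) (Cmult z (geom' lam m z))
  end.

Lemma geom_sum_n (lam z : C) (n : nat) :
  geom lam n z = sum_n (fun k => Cmult (Cpow lam k) (Cpow z (n - k))) n.
Proof.
  induction n as [|n IH].
  - rewrite sum_O; simpl; C_eq; ring.
  - rewrite (sum_n_conv_S (K := C_Ring) (fun k => Cpow lam k) (fun m => Cpow z m)).
    simpl geom; rewrite IH, <- (sum_n_mult_l (K := C_Ring)).
    change (@plus C_Ring) with Cplus; change (@mult C_Ring) with Cmult.
    f_equal; [|simpl; C_eq; ring].
    apply sum_n_ext; intros k; simpl; C_eq; ring.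
Qed.

Lemma geom'_sum_n (lam z : C) (n : nat) :
  geom' lam n z = sum_n (fun k => Cmult (Cpow lam k)
    (Cmult (RtoC (INR (n - k))) (Cpow z (pred (n - k))))) n.
Proof.
  induction n as [|n IH].
  - rewrite sum_O; simpl; C_eq; ring.
  - rewrite (sum_n_conv_S (K := C_Ring) (fun k => Cpow lam k)
      (fun m => Cmult (RtoC (INR m)) (Cpow z (pred m)))).
    simpl geom'; rewrite IH, geom_sum_n, <- (sum_n_mult_l (K := C_Ring)).
    change (@plus C_Ring) with Cplus; change (@mult C_Ring) with Cmult.
    rewrite <- (sum_n_plus (G := C_AbelianMonoid)).
    change (@plus C_AbelianMonoid) with Cplus.
    replace (Cmult (Cpow lam (S n)) (Cmult (RtoC (INR 0)) (Cpow z (pred 0))))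
      with (RtoC 0) by (simpl; ring).
    rewrite Cplus_0_r.
    apply sum_n_ext; intros k; destruct (n - k)%nat as [|m].
    + simpl; C_eq; ring.
    + rewrite (S_INR (S m)), RtoC_plus; simpl pred; simpl (Cpow z (S m)); C_eq; ring.
Qed.

(** The N of the overview is [S n], so that Q_j = [geom (node r s n j) n] has degree N - 1. *)
Definition node (r s : R) (n j : nat) : C :=
  polar r (s + INR j * (2 * PI / INR (S n))).

(** The sum is read as a polynomial in the node, with [z] frozen inside the coefficients [d].
    Parseval applies to the coefficients r^k e^{iks} d_k, and [s] disappears from their moduli. *)
Lemma parseval_nodes (r s : R) (n : nat) (d : nat -> C) :
  0 <= r ->
  sum_n (fun j => Cmod (sum_n (fun k => Cmult (Cpow (node r s n j) k) (d k)) n) ^ 2) n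
  = INR (S n) * sum_n (fun k => (r ^ 2) ^ k * Cmod (d k) ^ 2) n.
Proof.
  intros Hr.
  transitivity (INR (S n) *
    sum_n (fun k => Cmod (Cmult (polar (r ^ k) (INR k * s)) (d k)) ^ 2) n).
  - rewrite <- discrete_parseval.
    apply sum_n_ext; intros j; do 2 f_equal.
    apply sum_n_ext; intros k; unfold node.
    rewrite Cpow_polar.
    replace (polar (r ^ k) _) with (Cmult (polar (r ^ k) (INR k * s))
       (polar 1 (INR j * (2 * PI * INR k / INR (S n))))); [C_eq; ring|].
    rewrite polar_mult; f_equal; [ring|field].
    apply not_0_INR; lia.
  - f_equal; apply sum_n_ext; intros k.
    rewrite Cmod_mult, Cmod_polar by now apply pow_le.
    rewrite Rpow_mult_distr, <- !pow_mult; do 2 f_equal; lia.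
Qed.

Lemma geom_square_sum_le (r s : R) (n : nat) (z : C) :
  Cmod z < r ->
  (r ^ 2 - Cmod z ^ 2) * sum_n (fun j => Cmod (geom (node r s n j) n z) ^ 2) n
  <= INR (S n) * (r ^ 2) ^ S n.
Proof.
  intros Hz; pose proof (Cmod_ge_0 z).
  rewrite (sum_n_ext _ _ n (fun j => f_equal (fun w => Cmod w ^ 2)
    (geom_sum_n (node r s n j) z n))).
  rewrite parseval_nodes by lra.
  rewrite (sum_n_ext _ (fun k => (r ^ 2) ^ k * (Cmod z ^ 2) ^ (n - k))).
  - pose proof (weighted_sum0_le (r ^ 2) (Cmod z ^ 2) ltac:(nra) n).
    pose proof (pos_INR (S n)); nra.
  - intros k; rewrite Cmod_pow, <- (pow_mult _ (n - k)), <- (pow_mult _ 2 (n - k)).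
    do 2 f_equal; lia.
Qed.

Lemma geom'_square_sum_le (r s : R) (n : nat) (z : C) :
  Cmod z < r ->
  (r ^ 2 - Cmod z ^ 2) ^ 3 * sum_n (fun j => Cmod (geom' (node r s n j) n z) ^ 2) n
  <= INR (S n) * ((r ^ 2 + Cmod z ^ 2) * (r ^ 2) ^ S n).
Proof.
  intros Hz; pose proof (Cmod_ge_0 z).
  rewrite (sum_n_ext _ _ n (fun j => f_equal (fun w => Cmod w ^ 2)
    (geom'_sum_n (node r s n j) z n))).
  rewrite parseval_nodes by lra.
  rewrite (sum_n_ext _ (fun k => (r ^ 2) ^ k *
    (INR (n - k) ^ 2 * (Cmod z ^ 2) ^ pred (n - k)))).
  - pose proof (weighted_sum2_le (r ^ 2) (Cmod z ^ 2) ltac:(nra) ltac:(nra) n) as H1.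
    apply (Rmult_le_compat_l (INR (S n))) in H1; [|apply pos_INR]; lra.
  - intros k; rewrite Cmod_mult, Cmod_pow, Cmod_R, Rpow_mult_distr, pow2_abs.
    rewrite <- (pow_mult _ (pred (n - k))), <- (pow_mult _ 2 (pred (n - k))).
    do 3 f_equal; lia.
Qed.

(* [C_NormedModule] has the same norm but another uniform structure, and the
   product rule of Coquelicot is not available for it. *)
Notation C_is_derive := (@is_derive C_AbsRing (AbsRing_NormedModule C_AbsRing)).

Lemma is_derive_C_NormedModule (f : C -> C) (z l : C) :
  C_is_derive f z l ->
  is_derive (K := C_AbsRing) (V := C_NormedModule) f z l.
Proof.
  intros [[H1 H2 H3] H]; split; [split; [exact H1|exact H2|exact H3]|].
  intros x Hx eps; exact (H x Hx eps).
Qed.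

Lemma is_derive_C_mult (f g : C -> C) (z df dg : C) :
  C_is_derive f z df ->
  C_is_derive g z dg ->
  C_is_derive
    (fun w => Cmult (f w) (g w)) z (Cplus (Cmult df (g z)) (Cmult (f z) dg)).
Proof.
  intros Hf Hg; exact (is_derive_mult (K := C_AbsRing) f g z df dg Hf Hg Cmult_comm).
Qed.

Lemma is_derive_C_scal (a : C) (f : C -> C) (z df : C) :
  C_is_derive f z df -> C_is_derive (fun w => Cmult a (f w)) z (Cmult a df).
Proof.
  intros Hf.
  replace (Cmult a df) with (Cplus (Cmult 0 (f z)) (Cmult a df)) by ring.
  apply (is_derive_C_mult (fun _ => a)); [|exact Hf].
  exact (is_derive_const (K := C_AbsRing) (V := AbsRing_NormedModule C_AbsRing) a z).
Qed.

Lemma is_derive_C_sum_n (f df : nat -> C -> C) (n : nat) (z : C) :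
  (forall k, C_is_derive
     (f k) z (df k z)) ->
  C_is_derive
    (fun w => sum_n (fun k => f k w) n) z (sum_n (fun k => df k z) n).
Proof.
  intros H; induction n as [|n IH].
  - rewrite sum_O.
    apply (is_derive_ext (K := C_AbsRing) (V := AbsRing_NormedModule C_AbsRing)
             (f 0%nat)); [|apply H].
    intros w; now rewrite sum_O.
  - rewrite sum_Sn.
    apply (is_derive_ext (K := C_AbsRing) (V := AbsRing_NormedModule C_AbsRing)
             (fun w => plus (sum_n (fun k => f k w) n) (f (S n) w))).
    + intros w; now rewrite sum_Sn.
    + exact (is_derive_plus (K := C_AbsRing) (V := AbsRing_NormedModule C_AbsRing)
               _ _ z _ _ IH (H (S n))).
Qed.

Lemma is_derive_geom (lam z : C) (n : nat) :
  C_is_derive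
    (geom lam n) z (geom' lam n z).
Proof.
  induction n as [|n IH].
  - exact (is_derive_const (K := C_AbsRing) (V := AbsRing_NormedModule C_AbsRing)
             (RtoC 1) z).
  - replace (geom' lam (S n) z) with (plus
      (Cplus (Cmult 1 (geom lam n z)) (Cmult z (geom' lam n z))) (RtoC 0)).
    + apply (is_derive_plus (K := C_AbsRing) (V := AbsRing_NormedModule C_AbsRing)
        (fun w => Cmult w (geom lam n w)) (fun _ => Cpow lam (S n))).
      * apply is_derive_C_mult; [|exact IH].
        exact (is_derive_id (K := C_AbsRing) z).
      * exact (is_derive_const (K := C_AbsRing)
                 (V := AbsRing_NormedModule C_AbsRing) (Cpow lam (S n)) z).
    + simpl; change (@plus _) with Cplus; C_eq; ring.
Qed.

Lemma lipschitz_on_disc_geom (lam : C) (n : nat) : lipschitz_on_disc (geom lam n).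
Proof.
  induction n as [|n IH]; simpl.
  - apply lipschitz_on_disc_const.
  - apply (lipschitz_on_disc_plus (fun z => Cmult z (geom lam n z))).
    + apply lipschitz_on_disc_mult; auto using lipschitz_on_disc_id.
    + apply lipschitz_on_disc_const.
Qed.

Lemma lipschitz_on_disc_geom' (lam : C) (n : nat) : lipschitz_on_disc (geom' lam n).
Proof.
  induction n as [|n IH]; simpl.
  - apply lipschitz_on_disc_const.
  - apply (lipschitz_on_disc_plus (geom lam n) (fun z => Cmult z (geom' lam n z))).
    + apply lipschitz_on_disc_geom.
    + apply lipschitz_on_disc_mult; auto using lipschitz_on_disc_id.
Qed.

Definition geom_comb (eps lam : nat -> C) (n : nat) (z : C) : C :=
  sum_n (fun j => Cmult (eps j) (Cmult (geom (lam j) n z) (geom (lam j) n z))) n.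

(** The primitive A/(r - u) has one power of 1/(r - u) fewer, which is where the single factor 1/(r
    - 1) originates. *)
Lemma is_RInt_inv_square (r A : R) :
  1 < r -> is_RInt (fun u => A / (r - u) ^ 2) 0 1 (A / (r * (r - 1))).
Proof.
  intros Hr.
  replace (A / (r * (r - 1))) with (minus (A / (r - 1)) (A / (r - 0))).
  - apply (is_RInt_derive (fun u => A / (r - u)) (fun u => A / (r - u) ^ 2)).
    + rewrite Rmin_left, Rmax_right by lra; intros u Hu.
      auto_derive; [lra|field; lra].
    + rewrite Rmin_left, Rmax_right by lra; intros u Hu.
      apply (ex_derive_continuous (K := R_AbsRing) (V := R_NormedModule)).
      auto_derive; nra.
  - unfold minus, plus, opp; simpl; field; lra.
Qed.

Lemma B_norm_geom_comb_le (eps : nat -> C) (r s : R) (n : nat) :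
  1 < r -> (forall j, Cmod (eps j) <= 1) ->
  B_norm (geom_comb eps (node r s n) n)
  <= 7 * INR (S n) * (r ^ 2) ^ S n / ((r + 1) * (r - 1)).
Proof.
  intros Hr Heps.
  set (lam := node r s n); set (M := INR (S n) * (r ^ 2) ^ S n).
  assert (HM : 0 <= M).
  { apply Rmult_le_pos; [apply pos_INR|apply pow_le; nra]. }
  (* Integral of the derivative plus supremum over the disc. The majorant [G] comes from the two
     mean squares through r ((r+u)^2 + r^2 + u^2) <= 3 (r+u)^3. *)
  apply Rle_trans with ((3 * M / r) / (r * (r - 1)) + M / (r ^ 2 - 1)).
  { eapply B_norm_le with (G := fun u => (3 * M / r) / (r - u) ^ 2)
      (q := fun z => sum_n (fun j => Cmult (eps j)
        (Cplus (Cmult (geom' (lam j) n z) (geom (lam j) n z))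
               (Cmult (geom (lam j) n z) (geom' (lam j) n z)))) n).
    - intros z; apply is_derive_C_NormedModule.
      apply (is_derive_C_sum_n
        (fun j w => Cmult (eps j) (Cmult (geom (lam j) n w) (geom (lam j) n w)))
        (fun j w => Cmult (eps j)
          (Cplus (Cmult (geom' (lam j) n w) (geom (lam j) n w))
                 (Cmult (geom (lam j) n w) (geom' (lam j) n w))))).
      intros j; apply (is_derive_C_scal (eps j)
        (fun w => Cmult (geom (lam j) n w) (geom (lam j) n w))).
      apply (is_derive_C_mult (geom (lam j) n) (geom (lam j) n));
        apply is_derive_geom.
    - apply (lipschitz_on_disc_sum_n (fun j z => Cmult (eps j)
        (Cplus (Cmult (geom' (lam j) n z) (geom (lam j) n z))
               (Cmult (geom (lam j) n z) (geom' (lam j) n z))))).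
      pose proof lipschitz_on_disc_geom as Hg.
      pose proof lipschitz_on_disc_geom' as Hg'.
      intros j; apply lipschitz_on_disc_mult; [apply lipschitz_on_disc_const|].
      apply lipschitz_on_disc_plus; now apply lipschitz_on_disc_mult.
    - intros u t Hu.
      set (z := polar u t).
      assert (Hz : Cmod z = u) by (apply Cmod_polar; lra).
      pose proof (geom_square_sum_le r s n z ltac:(lra)) as H0.
      pose proof (geom'_square_sum_le r s n z ltac:(lra)) as H1.
      fold lam in H0, H1; rewrite Hz in H0, H1.
      set (Q := fun j => Cmod (geom (lam j) n z)).
      set (Q' := fun j => Cmod (geom' (lam j) n z)).
      (* The bound on the sum of Q'^2 exceeds that on Q^2 by about (r - u)^-2; the weight r - u
         balances the two contributions. *)
      apply Rle_trans with
        (/ (r - u) * sum_n (fun j => Q j ^ 2) n + (r - u) * sum_n (fun j => Q' j ^ 2) n).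
      + eapply Rle_trans; [apply Cmod_sum_n_le|].
        rewrite <- !(sum_n_mult_l (K := R_Ring)).
        rewrite <- (sum_n_plus (G := R_AbelianMonoid)).
        apply sum_n_Rle; intros j.
        change (@plus R_AbelianMonoid) with Rplus; change (@mult R_Ring) with Rmult.
        rewrite Cmod_mult.
        apply Rle_trans with (1 * (2 * (Q j * Q' j))).
        * apply Rmult_le_compat; auto using Cmod_ge_0.
          eapply Rle_trans; [apply Cmod_triangle|].
          rewrite !Cmod_mult; unfold Q, Q'; lra.
        * (* AM-GM: [2 Q Q' <= Q^2 / (r - u) + (r - u) Q'^2] *)
          assert (0 <= / (r - u) * (Q j - (r - u) * Q' j) ^ 2).
          { apply Rmult_le_pos; [apply Rlt_le, Rinv_0_lt_compat; lra|apply pow2_ge_0]. }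
          replace (/ (r - u) * (Q j - (r - u) * Q' j) ^ 2) with
            (/ (r - u) * Q j ^ 2 + (r - u) * Q' j ^ 2 - 2 * (Q j * Q' j)) in H
            by (field; lra).
          lra.
      + apply Rmult_le_reg_l with ((r ^ 2 - u ^ 2) ^ 3 * (r - u) ^ 2).
        { apply Rmult_lt_0_compat; apply pow_lt; nra. }
        fold M in H0.
        replace (INR (S n) * ((r ^ 2 + u ^ 2) * (r ^ 2) ^ S n))
          with ((r ^ 2 + u ^ 2) * M) in H1 by (unfold M; ring).
        apply (Rmult_le_compat_l ((r ^ 2 - u ^ 2) ^ 2 * (r - u))) in H0;
          [|apply Rmult_le_pos; [apply pow2_ge_0|lra]].
        apply (Rmult_le_compat_l ((r - u) ^ 3)) in H1; [|apply pow_le; lra].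
        apply Rle_trans with ((r ^ 2 - u ^ 2) ^ 2 * (r - u) * M +
          (r - u) ^ 3 * ((r ^ 2 + u ^ 2) * M)).
        { eapply Rle_trans; [|apply Rplus_le_compat; [apply H0|apply H1]].
          right; unfold Q, Q'; field; lra. }
        replace ((r ^ 2 - u ^ 2) ^ 3 * (r - u) ^ 2 * (3 * M / r / (r - u) ^ 2))
          with ((r - u) ^ 3 * M * (3 * (r + u) ^ 3 / r)) by (field; lra).
        replace (_ + _) with
          ((r - u) ^ 3 * M * ((r + u) ^ 2 + r ^ 2 + u ^ 2)) by ring.
        apply Rmult_le_compat_l.
        { apply Rmult_le_pos; [apply pow_le; lra|exact HM]. }
        apply Rmult_le_reg_r with r; [lra|].
        replace (3 * (r + u) ^ 3 / r * r) with (3 * (r + u) ^ 3) by (field; lra).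
        assert (0 <= u * r ^ 2) by (apply Rmult_le_pos; nra).
        assert (0 <= u * u * r) by (apply Rmult_le_pos; nra).
        assert (0 <= u ^ 3) by (apply pow_le; lra).
        assert (0 <= r ^ 3) by (apply pow_le; lra).
        lra.
    - now apply is_RInt_inv_square.
    - intros z Hz; pose proof (Cmod_ge_0 z).
      pose proof (geom_square_sum_le r s n z ltac:(lra)) as H0.
      fold lam M in H0.
      set (T := sum_n (fun j => Cmod (geom (lam j) n z) ^ 2) n) in H0.
      assert (HT : Cmod (geom_comb eps lam n z) <= T).
      { eapply Rle_trans; [apply Cmod_sum_n_le|].
        apply sum_n_Rle; intros j; rewrite !Cmod_mult.
        pose proof (Heps j); pose proof (pow2_ge_0 (Cmod (geom (lam j) n z))).
        pose proof (Cmod_ge_0 (eps j)); nra. }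
      apply Rle_trans with T; [exact HT|].
      apply Rmult_le_reg_l with (r ^ 2 - 1); [nra|].
      replace ((r ^ 2 - 1) * (M / (r ^ 2 - 1))) with M by (field; nra).
      eapply Rle_trans; [|exact H0].
      pose proof (Cmod_ge_0 (geom_comb eps lam n z)).
      apply Rmult_le_compat_r; nra. }
  assert (Hr1 : 0 < (r + 1) * (r - 1)) by (apply Rmult_lt_0_compat; lra).
  apply Rmult_le_reg_l with (r ^ 2 * ((r + 1) * (r - 1))).
  { apply Rmult_lt_0_compat; [nra|exact Hr1]. }
  replace (r ^ 2 - 1) with ((r + 1) * (r - 1)) by ring.
  replace (r ^ 2 * ((r + 1) * (r - 1)) * (_ + _))
    with (M * (3 * (r + 1) + r ^ 2)) by (field; lra).
  replace (r ^ 2 * ((r + 1) * (r - 1)) * _) with (M * (7 * r ^ 2))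
    by (unfold M; field; lra).
  (* The constant 7 arises here: 3 (r + 1) <= 6 r^2 for r > 1. *)
  apply Rmult_le_compat_l; nra.
Qed.

(** * Polynomials in a bounded operator *)

Lemma minus_eq {G : AbelianGroup} (x y : G) : minus x y = plus x (opp y).
Proof. reflexivity. Qed.

Lemma minus_plus_cancel {G : AbelianGroup} (a b : G) : plus (minus a b) b = a.
Proof. now rewrite minus_eq, <- plus_assoc, plus_opp_l, plus_zero_r. Qed.

Lemma minus_of_plus {G : AbelianGroup} (a b c : G) : a = plus b c -> minus a b = c.
Proof.
  intros ->; now rewrite minus_eq, (plus_comm b), <- plus_assoc, plus_opp_r, plus_zero_r.
Qed.

Lemma minus_minus_swap {G : AbelianGroup} (a b c d : G) :
  minus (minus a b) (minus c d) = minus (minus a c) (minus b d).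
Proof.
  rewrite !minus_eq, !opp_plus, !opp_opp, <- !plus_assoc; f_equal.
  rewrite !plus_assoc; f_equal; apply plus_comm.
Qed.

Lemma sum_n_shift {G : AbelianMonoid} (f : nat -> G) (n : nat) :
  sum_n f (S n) = plus (f 0%nat) (sum_n (fun k => f (S k)) n).
Proof.
  induction n as [|n IH].
  - now rewrite sum_Sn, !sum_O.
  - rewrite sum_Sn, IH, sum_Sn, plus_assoc; easy.
Qed.

Lemma scal_C0 {V : NormedModule C_AbsRing} (x : V) :
  scal (RtoC 0 : C_AbsRing) x = zero.
Proof. exact (scal_zero_l x). Qed.

Lemma scal_C1 {V : NormedModule C_AbsRing} (x : V) :
  scal (RtoC 1 : C_AbsRing) x = x.
Proof. exact (scal_one x). Qed.

(** The reverse of [norm_scal] is [norm_scal] itself for the scalar [Cinv l] and the vector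
    [scal l x]. *)
Lemma norm_scal_C {V : NormedModule C_AbsRing} (l : C) (x : V) :
  norm (scal (l : C_AbsRing) x) = Cmod l * norm x.
Proof.
  apply Rle_antisym; [exact (norm_scal (l : C_AbsRing) x)|].
  destruct (Ceq_dec l 0) as [->|Hl].
  - rewrite Cmod_0, Rmult_0_l; apply norm_ge_0.
  - assert (Hp : 0 < Cmod l) by now apply Cmod_gt_0.
    pose proof (norm_scal (Cinv l : C_AbsRing) (scal (l : C_AbsRing) x)) as H.
    rewrite scal_assoc in H.
    change (mult (Cinv l : C_AbsRing) (l : C_AbsRing)) with (Cmult (Cinv l) l) in H.
    rewrite Cinv_l in H by exact Hl.
    rewrite scal_C1 in H.
    change (abs (Cinv l : C_AbsRing)) with (Cmod (Cinv l)) in H.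
    rewrite Cmod_inv in H by exact Hl.
    apply (Rmult_le_compat_l (Cmod l)) in H; [|lra].
    rewrite <- Rmult_assoc, Rinv_r, Rmult_1_l in H by lra; exact H.
Qed.

Lemma is_linear_add {U V : NormedModule C_AbsRing} (f g : U -> V) :
  is_linear f -> is_linear g -> is_linear (fun x => plus (f x) (g x)).
Proof.
  intros Hf Hg.
  exact (is_linear_comp _ _ (is_linear_prod f g Hf Hg) is_linear_plus).
Qed.

Lemma is_linear_mul_scal {U V : NormedModule C_AbsRing} (k : C) (f : U -> V) :
  is_linear f -> is_linear (fun x => scal (k : C_AbsRing) (f x)).
Proof.
  intros Hf; apply (is_linear_comp f _ Hf).
  exact (is_linear_scal_r (K := C_AbsRing) k Cmult_comm).
Qed.

Lemma is_linear_minus {U V : NormedModule C_AbsRing} (f g : U -> V) :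
  is_linear f -> is_linear g -> is_linear (fun x => minus (f x) (g x)).
Proof.
  intros Hf Hg; apply (is_linear_add f (fun x => opp (g x)) Hf).
  exact (is_linear_comp g opp Hg is_linear_opp).
Qed.

Lemma is_linear_sum_n {U V : NormedModule C_AbsRing} (f : nat -> U -> V) (n : nat) :
  (forall k, is_linear (f k)) -> is_linear (fun x => sum_n (fun k => f k x) n).
Proof.
  intros Hf; induction n as [|n IH].
  - apply is_linear_ext with (f 0%nat); auto; intros x; now rewrite sum_O.
  - apply is_linear_ext with (fun x => plus (sum_n (fun k => f k x) n) (f (S n) x)).
    + intros x; now rewrite sum_Sn.
    + now apply is_linear_add.
Qed.

Lemma linear_sum_n {U V : NormedModule C_AbsRing} (l : U -> V) (f : nat -> U) (n : nat) :
  is_linear l -> l (sum_n f n) = sum_n (fun k => l (f k)) n.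
Proof.
  intros Hl; induction n as [|n IH]; [now rewrite !sum_O|].
  now rewrite !sum_Sn, (linear_plus l Hl), IH.
Qed.

Section OperatorNorm.

Context {V W : NormedModule C_AbsRing} (S : V -> W) (hS : is_linear S).

Let E (y : R) := exists x : V, norm x <= 1 /\ y = norm (S x).

Lemma unit_ball_image_bounded : exists M, forall y, E y -> y <= M.
Proof.
  destruct (linear_norm S hS) as (M & HM & HSM).
  exists M; intros y (x & Hx & ->).
  pose proof (HSM x); pose proof (norm_ge_0 x); nra.
Qed.

Lemma sup_unit_ball_ge_0 : 0 <= sup E.
Proof.
  destruct unit_ball_image_bounded as (M & HM).
  apply Rle_trans with (norm (S zero)); [apply norm_ge_0|].
  apply le_sup with M; [|exact HM].
  exists zero; split; [rewrite norm_zero; lra|easy].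
Qed.

Lemma norm_le_sup_unit_ball (x : V) : norm (S x) <= sup E * norm x.
Proof.
  destruct unit_ball_image_bounded as (M & HM).
  destruct (norm_ge_0 x) as [Hx|Hx].
  - set (k := RtoC (/ norm x)).
    assert (Hk : Cmod k = / norm x).
    { unfold k; rewrite Cmod_R; apply Rabs_pos_eq, Rlt_le, Rinv_0_lt_compat, Hx. }
    assert (H : norm (S (scal (k : C_AbsRing) x)) <= sup E).
    { apply le_sup with M; [|exact HM].
      exists (scal (k : C_AbsRing) x); split; [|easy].
      rewrite norm_scal_C, Hk, Rinv_l; lra. }
    rewrite (linear_scal S hS), norm_scal_C, Hk in H.
    apply (Rmult_le_compat_r (norm x)) in H; [|lra].
    replace (/ norm x * norm (S x) * norm x) with (norm (S x)) in H
      by (field; lra); exact H.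
  - rewrite <- Hx, (norm_eq_zero x) by easy.
    rewrite (linear_zero S hS), norm_zero; lra.
Qed.

End OperatorNorm.

Lemma op_norm_ge_0 {X : CompleteNormedModule C_AbsRing} {Y : NormedModule C_AbsRing}
  (S : X -> Y) : is_linear S -> 0 <= op_norm S.
Proof. exact (sup_unit_ball_ge_0 S). Qed.

Lemma norm_le_op_norm {X : CompleteNormedModule C_AbsRing} {Y : NormedModule C_AbsRing}
  (S : X -> Y) (x : X) : is_linear S -> norm (S x) <= op_norm S * norm x.
Proof. intros HS; exact (norm_le_sup_unit_ball S HS x). Qed.

(** * Polynomial calculus and the factorisation of lam^N - T^N *)

Section PolynomialCalculus.

Context {X : NormedModule C_AbsRing} (T : X -> X) (hT : is_linear T).

(** [poly_apply] and [char_op] are [poly_op] and [shift] over a module not assumed complete; on a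
    complete one they agree by conversion. *)
Definition poly_apply (n : nat) (a : nat -> C) (x : X) : X :=
  sum_n (fun k => scal (a k : C_AbsRing) (Nat.iter k T x)) n.

Definition char_op (lam : C) (x : X) : X := minus (scal (lam : C_AbsRing) x) (T x).

Lemma is_linear_iter (n : nat) : is_linear (Nat.iter n T).
Proof.
  induction n as [|n IH]; [exact is_linear_id|].
  exact (is_linear_comp _ T IH hT).
Qed.

Lemma is_linear_poly_apply (n : nat) (a : nat -> C) : is_linear (poly_apply n a).
Proof.
  apply (is_linear_sum_n (fun k x => scal (a k : C_AbsRing) (Nat.iter k T x))).
  intros k; apply is_linear_mul_scal, is_linear_iter.
Qed.

(** The hypothesis of the theorem is phrased with coefficients. Asking only that [p] and [A] share
    some coefficients lets polynomials be built by algebra without expanding products. *)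
Definition poly_calculus (n : nat) (p : C -> C) (A : X -> X) : Prop :=
  exists a, poly_eval n a = p /\ poly_apply n a = A.

Lemma poly_calculus_const (c : C) :
  poly_calculus 0 (fun _ => c) (fun x => scal (c : C_AbsRing) x).
Proof.
  exists (fun _ => c); split; apply functional_extensionality; intros z.
  - unfold poly_eval; rewrite sum_O; simpl; ring.
  - unfold poly_apply; now rewrite sum_O.
Qed.

Lemma poly_calculus_S (n : nat) (p : C -> C) (A : X -> X) :
  poly_calculus n p A -> poly_calculus (S n) p A.
Proof.
  intros (a & <- & <-).
  exists (fun k => if (k <=? n)%nat then a k else RtoC 0).
  assert (Hn : (S n <=? n)%nat = false) by (apply Nat.leb_gt; lia).
  split; apply functional_extensionality; intros z.
  - unfold poly_eval; rewrite sum_Sn, Hn.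
    rewrite Cmult_0_l; change (@plus _) with Cplus; rewrite Cplus_0_r.
    apply sum_n_ext_loc; intros k Hk.
    now apply Nat.leb_le in Hk as ->.
  - unfold poly_apply; rewrite sum_Sn, Hn.
    rewrite scal_C0, plus_zero_r.
    apply sum_n_ext_loc; intros k Hk.
    now apply Nat.leb_le in Hk as ->.
Qed.

Lemma poly_calculus_le (n m : nat) (p : C -> C) (A : X -> X) :
  (n <= m)%nat -> poly_calculus n p A -> poly_calculus m p A.
Proof.
  induction 1; auto using poly_calculus_S.
Qed.

Lemma poly_calculus_plus (n : nat) (p q : C -> C) (A B : X -> X) :
  poly_calculus n p A -> poly_calculus n q B ->
  poly_calculus n (fun z => Cplus (p z) (q z)) (fun x => plus (A x) (B x)).
Proof.
  intros (a & <- & <-) (b & <- & <-).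
  exists (fun k => Cplus (a k) (b k)).
  split; apply functional_extensionality; intros z.
  - unfold poly_eval.
    transitivity (plus (sum_n (fun k => Cmult (a k) (Cpow z k)) n)
                       (sum_n (fun k => Cmult (b k) (Cpow z k)) n)); [|easy].
    rewrite <- sum_n_plus; apply sum_n_ext; intros k.
    apply Cmult_plus_distr_r.
  - unfold poly_apply; rewrite <- sum_n_plus; apply sum_n_ext; intros k.
    exact (scal_distr_r (a k : C_AbsRing) (b k) (Nat.iter k T z)).
Qed.

Lemma poly_calculus_scal (n : nat) (c : C) (p : C -> C) (A : X -> X) :
  poly_calculus n p A ->
  poly_calculus n (fun z => Cmult c (p z)) (fun x => scal (c : C_AbsRing) (A x)).
Proof.
  intros (a & <- & <-).
  exists (fun k => Cmult c (a k)).
  split; apply functional_extensionality; intros z.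
  - unfold poly_eval.
    rewrite <- (sum_n_mult_l (K := C_Ring)); apply sum_n_ext; intros k.
    symmetry; apply Cmult_assoc.
  - unfold poly_apply; rewrite <- sum_n_scal_l; apply sum_n_ext; intros k.
    now rewrite scal_assoc.
Qed.

Lemma poly_calculus_mul_X (n : nat) (p : C -> C) (A : X -> X) :
  poly_calculus n p A ->
  poly_calculus (S n) (fun z => Cmult z (p z)) (fun x => T (A x)).
Proof.
  intros (a & <- & <-).
  exists (fun k => match k with O => RtoC 0 | S m => a m end).
  split; apply functional_extensionality; intros z.
  - unfold poly_eval; rewrite sum_n_shift.
    rewrite Cmult_0_l; change (@plus _) with Cplus; rewrite Cplus_0_l.
    rewrite <- (sum_n_mult_l (K := C_Ring)); apply sum_n_ext; intros k.
    change (@mult C_Ring) with Cmult; simpl; C_eq; ring.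
  - unfold poly_apply; rewrite sum_n_shift.
    rewrite scal_C0, plus_zero_l, (linear_sum_n T _ n hT).
    apply sum_n_ext; intros k; now rewrite (linear_scal T hT).
Qed.

Lemma poly_calculus_sum_n (n m : nat) (p : nat -> C -> C) (A : nat -> X -> X) :
  (forall j, poly_calculus n (p j) (A j)) ->
  poly_calculus n (fun z => sum_n (fun j => p j z) m) (fun x => sum_n (fun j => A j x) m).
Proof.
  intros H; induction m as [|m IH].
  - replace (fun z => sum_n (fun j => p j z) 0) with (p 0%nat);
    [replace (fun x => sum_n (fun j => A j x) 0) with (A 0%nat); [apply H|]|];
    apply functional_extensionality; intros z; now rewrite sum_O.
  - replace (fun z => sum_n (fun j => p j z) (S m)) with
      (fun z => Cplus (sum_n (fun j => p j z) m) (p (S m) z));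
    [replace (fun x => sum_n (fun j => A j x) (S m)) with
      (fun x => plus (sum_n (fun j => A j x) m) (A (S m) x));
      [now apply poly_calculus_plus|]|];
    apply functional_extensionality; intros z; now rewrite sum_Sn.
Qed.

Fixpoint geom_op (lam : C) (n : nat) (x : X) : X :=
  match n with
  | O => x
  | S m => plus (T (geom_op lam m x)) (scal (Cpow lam n : C_AbsRing) x)
  end.

(** The Horner recursion, common to [geom] and [geom_op], reduces this product to multiplications by
    z and additions, so no convolution of coefficients appears. *)
Lemma poly_calculus_geom_mult (lam : C) (n m : nat) (p : C -> C) (A : X -> X) :
  poly_calculus m p A ->
  poly_calculus (n + m) (fun z => Cmult (geom lam n z) (p z))
    (fun x => geom_op lam n (A x)).
Proof.
  intros Hp; induction n as [|n IH].
  - replace (fun z => Cmult (geom lam 0 z) (p z)) with p; [exact Hp|].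
    apply functional_extensionality; intros z; simpl; ring.
  - replace (fun z => Cmult (geom lam (S n) z) (p z)) with
      (fun z => Cplus (Cmult z (Cmult (geom lam n z) (p z))) (Cmult (Cpow lam (S n)) (p z)))
      by (apply functional_extensionality; intros z; simpl; ring).
    apply (poly_calculus_plus _ _ _ (fun x => T (geom_op lam n (A x)))
      (fun x => scal (Cpow lam (S n) : C_AbsRing) (A x))).
    + now apply (poly_calculus_mul_X _ _ (fun x => geom_op lam n (A x))).
    + apply poly_calculus_scal, poly_calculus_le with m; [lia|exact Hp].
Qed.

Lemma poly_calculus_geom (lam : C) (n : nat) :
  poly_calculus n (geom lam n) (geom_op lam n).
Proof.
  pose proof (poly_calculus_geom_mult lam n 0 _ _ (poly_calculus_const 1)) as H.
  rewrite Nat.add_0_r in H.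
  replace (geom lam n) with (fun z => Cmult (geom lam n z) 1)
    by (apply functional_extensionality; intros z; ring).
  replace (geom_op lam n) with (fun x => geom_op lam n (scal (RtoC 1 : C_AbsRing) x));
    [exact H|].
  apply functional_extensionality; intros x.
  now rewrite scal_C1.
Qed.

Lemma poly_calculus_geom_comb (eps lam : nat -> C) (n : nat) :
  poly_calculus (n + n) (geom_comb eps lam n)
    (fun x => sum_n (fun j => scal (eps j : C_AbsRing)
       (geom_op (lam j) n (geom_op (lam j) n x))) n).
Proof.
  apply (poly_calculus_sum_n _ _
    (fun j z => Cmult (eps j) (Cmult (geom (lam j) n z) (geom (lam j) n z)))
    (fun j x => scal (eps j : C_AbsRing) (geom_op (lam j) n (geom_op (lam j) n x)))).
  intros j; apply (poly_calculus_scal _ _ _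
    (fun x => geom_op (lam j) n (geom_op (lam j) n x))).
  apply poly_calculus_geom_mult, poly_calculus_geom.
Qed.

Definition pow_shift (L : C) (N : nat) (x : X) : X :=
  minus (scal (L : C_AbsRing) x) (Nat.iter N T x).

Lemma is_linear_pow_shift (L : C) (N : nat) : is_linear (pow_shift L N).
Proof.
  apply (is_linear_minus (fun x : X => scal (L : C_AbsRing) x) (Nat.iter N T)).
  - exact (is_linear_mul_scal L (fun x : X => x) is_linear_id).
  - apply is_linear_iter.
Qed.

Lemma pow_shift_comm (L lam : C) (N : nat) (y : X) :
  pow_shift L N (char_op lam y) = char_op lam (pow_shift L N y).
Proof.
  unfold pow_shift, char_op.
  rewrite (linear_minus T _ _ hT), (linear_minus _ _ _ (is_linear_iter N)).
  rewrite (linear_scal T hT), (linear_scal _ (is_linear_iter N)).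
  rewrite !scal_minus_distr_l, !scal_assoc, minus_minus_swap.
  rewrite <- Nat.iter_swap.
  change (@mult (AbsRing.Ring C_AbsRing)) with Cmult.
  rewrite (Cmult_comm L lam); easy.
Qed.

(** The factorisation Q(T)(lam - T) = lam^N - T^N; in the induction step the terms in lam^(n+1) T y
    cancel. *)
Lemma geom_op_shift (lam : C) (n : nat) (y : X) :
  geom_op lam n (char_op lam y) = pow_shift (Cpow lam (S n)) (S n) y.
Proof.
  induction n as [|n IH].
  - unfold pow_shift, char_op; simpl; now rewrite Cmult_1_r.
  - change (geom_op lam (S n) (char_op lam y)) with
      (plus (T (geom_op lam n (char_op lam y)))
        (scal (Cpow lam (S n) : C_AbsRing) (char_op lam y))).
    rewrite IH; unfold pow_shift, char_op.
    rewrite (linear_minus T _ _ hT), (linear_scal T hT).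
    rewrite scal_minus_distr_l, scal_assoc.
    change (mult (Cpow lam (S n) : C_AbsRing) (lam : C_AbsRing))
      with (Cmult (Cpow lam (S n)) lam).
    rewrite (Cmult_comm (Cpow lam (S n)) lam).
    change (Cmult lam (Cpow lam (S n))) with (Cpow lam (S (S n))).
    change (T (Nat.iter (S n) T y)) with (Nat.iter (S (S n)) T y).
    rewrite plus_comm; symmetry.
    exact (minus_trans (scal (Cpow lam (S n) : C_AbsRing) (T y)) _ _).
Qed.

(** Meant for y = R(lam, T)^2 x, where the left side is Q(T)^2 x. *)
Lemma geom_op_square (lam : C) (n : nat) (y : X) :
  geom_op lam n (geom_op lam n (char_op lam (char_op lam y)))
  = pow_shift (Cpow lam (S n)) (S n) (pow_shift (Cpow lam (S n)) (S n) y).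
Proof.
  now rewrite (geom_op_shift _ _ (char_op lam y)), pow_shift_comm, geom_op_shift.
Qed.

(** In the triangle inequality for L y = (L - T^N) y + T^N y, the last term is at most half of the
    left side. *)
Lemma norm_pow_shift_ge (L : C) (N : nat) (M : R) (y : X) :
  (forall x, norm (Nat.iter N T x) <= M * norm x) -> 2 * M <= Cmod L ->
  Cmod L * norm y <= 2 * norm (pow_shift L N y).
Proof.
  intros HM HL.
  pose proof (norm_triangle (pow_shift L N y) (Nat.iter N T y)) as H.
  replace (plus (pow_shift L N y) (Nat.iter N T y)) with (scal (L : C_AbsRing) y) in H
    by (symmetry; exact (minus_plus_cancel _ _)).
  rewrite norm_scal_C in H.
  pose proof (HM y); pose proof (norm_ge_0 y); nra.
Qed.

End PolynomialCalculus.

(** * Powers, resolvents and folded integrals *)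

(** Monomials are treated as [geom 0 n], so that the derivative, regularity and calculus of [geom]
    cover them too. *)
Lemma geom_0 (n : nat) (z : C) : geom 0 n z = Cpow z n.
Proof.
  induction n as [|n IH]; [easy|].
  simpl; rewrite IH; ring.
Qed.

Lemma geom'_0 (n : nat) (z : C) :
  geom' 0 (S n) z = Cmult (RtoC (INR (S n))) (Cpow z n).
Proof.
  induction n as [|n IH]; [simpl; ring|].
  change (geom' 0 (S (S n)) z) with
    (Cplus (geom 0 (S n) z) (Cmult z (geom' 0 (S n) z))).
  rewrite IH, geom_0, (S_INR (S n)), RtoC_plus; simpl Cpow; ring.
Qed.

(** For n >= 1 the integral of n u^(n-1) over [0, 1] contributes 1, and the supremum over the disc
    at most 1. *)
Lemma B_norm_geom_0_le (n : nat) : B_norm (geom 0 n) <= 2.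
Proof.
  assert (Hb : forall z, Cmod z < 1 -> Cmod (geom 0 n z) <= 1).
  { intros z Hz; rewrite geom_0, Cmod_pow, <- (pow1 n).
    apply pow_incr; split; [apply Cmod_ge_0|lra]. }
  assert (Hd : forall z : C,
    is_derive (V := C_NormedModule) (geom 0 n) z (geom' 0 n z)).
  { intros z; apply is_derive_C_NormedModule, is_derive_geom. }
  destruct n as [|n].
  - apply Rle_trans with (0 + 1); [|lra].
    apply B_norm_le with (geom' 0 0) (fun _ => 0); auto.
    + apply lipschitz_on_disc_geom'.
    + intros u t _; simpl; rewrite Cmod_0; lra.
    + pose proof (is_RInt_const (V := R_NormedModule) 0 1 0) as H.
      change (scal (1 - 0) 0) with ((1 - 0) * 0) in H.
      rewrite Rmult_0_r in H; exact H.
  - apply B_norm_le with (geom' 0 (S n)) (fun u => INR (S n) * u ^ n); auto.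
    + apply lipschitz_on_disc_geom'.
    + intros u t Hu; rewrite geom'_0, Cmod_mult, Cmod_R, Cmod_pow, Cmod_polar by lra.
      rewrite Rabs_pos_eq by apply pos_INR; lra.
    + assert (H : is_RInt (fun u => INR (S n) * u ^ n) 0 1 (1 ^ S n - 0 ^ S n)).
      { apply (is_RInt_derive (fun u => u ^ S n)).
        - intros u _; auto_derive; [easy|exact (Rmult_1_l _)].
        - intros u _; apply (ex_derive_continuous (K := R_AbsRing) (V := R_NormedModule)).
          auto_derive; easy. }
      rewrite pow1, pow_i, Rminus_0_r in H by lia; exact H.
Qed.

Lemma geom_op_0 {V : NormedModule C_AbsRing} (T : V -> V) (n : nat) (x : V) :
  geom_op T 0 n x = Nat.iter n T x.
Proof.
  induction n as [|n IH]; [easy|].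
  simpl; rewrite IH, Cmult_0_l, scal_C0; apply plus_zero_r.
Qed.

(** A chord is no longer than its arc: e^{ia} - e^{ib} = 2 i sin((a-b)/2) e^{i(a+b)/2}. *)
Lemma polar_lipschitz (r a b : R) :
  0 <= r -> Cmod (Cminus (polar r a) (polar r b)) <= r * Rabs (a - b).
Proof.
  intros Hr.
  set (d := (a - b) / 2).
  replace (Cminus (polar r a) (polar r b)) with
    (Cmult (polar r ((a + b) / 2)) (Cmult (RtoC (2 * sin d)) Ci)).
  - rewrite !Cmod_mult, Cmod_polar, Cmod_R by exact Hr.
    replace (Cmod Ci) with 1
      by (symmetry; transitivity (sqrt 1); [unfold Cmod, Ci; simpl; f_equal; ring|apply sqrt_1]).
    rewrite Rmult_1_r; apply Rmult_le_compat_l; [exact Hr|].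
    replace (a - b) with (2 * d) by (unfold d; field).
    rewrite !Rabs_mult; apply Rmult_le_compat_l; [apply Rabs_pos|].
    assert (H : forall x, 0 <= x -> Rabs (sin x) <= x).
    { intros x Hx; destruct (Rle_or_lt x 1) as [H1|H1].
      - pose proof PI2_1; pose proof PI_RGT_0.
        rewrite Rabs_pos_eq by (apply sin_ge_0; lra).
        destruct Hx as [Hx|<-]; [left; now apply sin_lt_x|rewrite sin_0; lra].
      - pose proof (SIN_bound x); apply Rabs_le; lra. }
    destruct (Rle_or_lt 0 d) as [Hd|Hd].
    + rewrite (Rabs_pos_eq d) by exact Hd; auto.
    + rewrite <- (Rabs_Ropp (sin d)), <- (Rabs_Ropp d), <- sin_neg.
      rewrite (Rabs_pos_eq (- d)) by lra; apply H; lra.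
  - replace a with ((a + b) / 2 + d) by (unfold d; field).
    (* The fourth occurrence is the angle of [polar r b]; the earlier ones belong to midpoints. *)
    replace b with ((a + b) / 2 - d) at 4 by (unfold d; field).
    replace (((a + b) / 2 + d + b) / 2) with ((a + b) / 2) by (unfold d; field).
    unfold polar, Cmult, Cminus, Cplus, Copp, RtoC, Ci; simpl.
    rewrite cos_plus, cos_minus, sin_plus, sin_minus; f_equal; ring.
Qed.

(** * Local Lipschitz continuity of the squared resolvent *)

Section SquaredResolvent.

Context {V : NormedModule C_AbsRing} (T : V -> V) (hT : is_linear T).

Lemma char_op_diff (lam mu : C) (y : V) :
  char_op T lam y = plus (char_op T mu y) (scal (Cminus lam mu : C_AbsRing) y).
Proof.
  assert (H : scal (Cminus lam mu : C_AbsRing) y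
    = minus (scal (lam : C_AbsRing) y) (scal (mu : C_AbsRing) y))
    by exact (scal_minus_distr_r (lam : C_AbsRing) mu y).
  rewrite H, plus_comm; exact (minus_trans _ _ _).
Qed.

Context (lam mu : C) (S S' : V -> V) (M : R)
  (hS : is_linear S) (hM : 0 < M) (hSM : forall x, norm (S x) <= M * norm x)
  (hSl : forall x, S (char_op T lam x) = x) (hS' : is_linear S')
  (hSr' : forall x, char_op T mu (S' x) = x)
  (hnear : M * Cmod (Cminus lam mu) <= 1 / 2).

(** The resolvent identity, obtained by applying [S] to (lam - T) S'x = x + (lam - mu) S'x. *)
Lemma resolvent_diff (x : V) :
  S' x = plus (S x) (S (scal (Cminus lam mu : C_AbsRing) (S' x))).
Proof.
  rewrite <- (linear_plus S hS).
  rewrite <- (hSr' x) at 2.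
  now rewrite <- char_op_diff, hSl.
Qed.

(** By [hnear] the correction in [resolvent_diff] is at most half of [norm (S' x)] and is absorbed
    on the left; [M] thus controls all nearby resolvents. *)
Lemma norm_near_resolvent_le (x : V) : norm (S' x) <= 2 * M * norm x.
Proof.
  pose proof (resolvent_diff x) as E.
  apply (f_equal norm) in E.
  pose proof (norm_triangle (S x) (S (scal (Cminus lam mu : C_AbsRing) (S' x)))).
  pose proof (hSM x).
  pose proof (hSM (scal (Cminus lam mu : C_AbsRing) (S' x))) as H1.
  rewrite norm_scal_C, <- Rmult_assoc in H1.
  pose proof (norm_ge_0 (S' x)).
  apply (Rmult_le_compat_r (norm (S' x))) in hnear; [|easy]; lra.
Qed.

Lemma norm_resolvent_diff_le (x : V) :
  norm (minus (S' x) (S x)) <= 2 * M ^ 2 * Cmod (Cminus lam mu) * norm x.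
Proof.
  rewrite (minus_of_plus _ _ _ (resolvent_diff x)).
  eapply Rle_trans; [apply hSM|].
  rewrite norm_scal_C.
  pose proof (norm_near_resolvent_le x); pose proof (Cmod_ge_0 (Cminus lam mu)).
  replace (2 * M ^ 2 * Cmod (Cminus lam mu) * norm x)
    with (M * (Cmod (Cminus lam mu) * (2 * M * norm x))) by ring.
  apply Rmult_le_compat_l; [lra|]; now apply Rmult_le_compat_l.
Qed.

(** From S'S' - SS = S'(S' - S) + (S' - S)S; the two terms contribute 4 M^3 and 2 M^3. *)
Lemma norm_resolvent_square_diff_le (x : V) :
  norm (minus (S' (S' x)) (S (S x)))
  <= 6 * M ^ 3 * Cmod (Cminus lam mu) * norm x.
Proof.
  rewrite (minus_trans (S' (S x)) (S' (S' x)) (S (S x))).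
  eapply Rle_trans; [apply norm_triangle|].
  rewrite <- (linear_minus S' _ _ hS').
  pose proof (norm_near_resolvent_le (minus (S' x) (S x))) as H1.
  pose proof (norm_resolvent_diff_le x) as H2.
  pose proof (norm_resolvent_diff_le (S x)) as H3.
  pose proof (hSM x) as H4.
  apply (Rmult_le_compat_l (2 * M)) in H2; [|lra].
  apply (Rmult_le_compat_l (2 * M ^ 2 * Cmod (Cminus lam mu))) in H4.
  - lra.
  - apply Rmult_le_pos; [nra|apply Cmod_ge_0].
Qed.

End SquaredResolvent.

Lemma is_RInt_fold (h : R -> R) (delta : R) (n : nat) :
  (forall t, continuous h t) ->
  is_RInt (fun s => sum_n (fun j => h (s + INR j * delta)) n) 0 delta
    (RInt h 0 (INR (S n) * delta)).
Proof.
  intros Hh.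
  assert (Hex : forall a b, ex_RInt h a b)
    by (intros a b; apply (ex_RInt_continuous h); auto).
  assert (Hshift : forall j, is_RInt (fun s => h (s + INR j * delta)) 0 delta
     (RInt h (INR j * delta) (INR (S j) * delta))).
  { intros j.
    apply (is_RInt_ext (fun s => scal 1 (h (1 * s + INR j * delta)))).
    - intros s _; now rewrite !Rmult_1_l.
    - apply (is_RInt_comp_lin h 1 (INR j * delta) 0 delta).
      replace (1 * 0 + INR j * delta) with (INR j * delta) by ring.
      replace (1 * delta + INR j * delta) with (INR (S j) * delta)
        by (rewrite S_INR; ring).
      apply (RInt_correct h), Hex. }
  induction n as [|n IH].
  - apply (is_RInt_ext (fun s => h (s + INR 0 * delta))).
    + intros s _; now rewrite sum_O.
    + assert (E : INR 0 * delta = 0) by (simpl; ring).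
      rewrite <- E at 2; apply (Hshift 0%nat).
  - apply (is_RInt_ext (fun s =>
      plus (sum_n (fun j => h (s + INR j * delta)) n) (h (s + INR (S n) * delta)))).
    + intros s _; now rewrite sum_Sn.
    + rewrite <- (RInt_Chasles h 0 (INR (S n) * delta)) by apply Hex.
      exact (is_RInt_plus (V := R_NormedModule) _ _ _ _ _ _ IH (Hshift (S n))).
Qed.

Lemma RInt_fold_le (h : R -> R) (delta B : R) (n : nat) :
  0 <= delta -> (forall t, continuous h t) ->
  (forall s, sum_n (fun j => h (s + INR j * delta)) n <= B) ->
  RInt h 0 (INR (S n) * delta) <= delta * B.
Proof.
  intros Hd Hh HB.
  pose proof (is_RInt_fold h delta n Hh) as H.
  rewrite <- (is_RInt_unique _ _ _ _ H).
  replace (delta * B) with (RInt (fun _ => B) 0 delta)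
    by (rewrite RInt_const; unfold scal; simpl; unfold mult; simpl; ring).
  apply RInt_le; [exact Hd|now exists (RInt h 0 (INR (S n) * delta))| |auto].
  apply (ex_RInt_const (V := R_NormedModule)).
Qed.

(** * The bound on the resolvent *)

(* At [0] this is [0], whatever the value of [/ 0]. *)
Definition conj_phase (w : C) : C := Cmult (Cconj w) (RtoC (/ Cmod w)).

Lemma Cmod_conj_phase_le (w : C) : Cmod (conj_phase w) <= 1.
Proof.
  unfold conj_phase; rewrite Cmod_mult, Cmod_conj, Cmod_R.
  destruct (Cmod_ge_0 w) as [H|H].
  - rewrite Rabs_pos_eq by now apply Rlt_le, Rinv_0_lt_compat.
    right; field; lra.
  - rewrite <- H; lra.
Qed.

Lemma conj_phase_mult (w : C) : Cmult (conj_phase w) w = RtoC (Cmod w).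
Proof.
  unfold conj_phase.
  replace (Cmult (Cmult (Cconj w) (RtoC (/ Cmod w))) w) with
    (Cmult (Cmult w (Cconj w)) (RtoC (/ Cmod w))) by ring.
  rewrite <- Cmod2_conj, <- RtoC_mult; f_equal.
  destruct (Cmod_ge_0 w) as [H|H]; [field; lra|rewrite <- H; ring].
Qed.

Lemma Cpow_node (r s : R) (n j : nat) :
  Cpow (node r s n j) (S n) = polar (r ^ S n) (INR (S n) * s).
Proof.
  unfold node; rewrite Cpow_polar.
  assert (HN : INR (S n) <> 0) by (apply not_0_INR; lia).
  replace (INR (S n) * (s + INR j * (2 * PI / INR (S n)))) with
    (INR (S n) * s + 2 * INR j * PI) by (field; exact HN).
  unfold polar; now rewrite cos_period, sin_period.
Qed.

Section CalculusToResolvent.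

Context {X : CompleteNormedModule C_AbsRing} (T : X -> X) (hT : is_linear T)
  (hspec : spectrum_in_closed_disc T) (K : R) (hK : 0 < K)
  (hP : forall n a, op_norm (poly_op n a T) <= K * B_norm (poly_eval n a)).

Lemma norm_poly_calculus_le (n : nat) (p : C -> C) (A : X -> X) (x : X) :
  poly_calculus T n p A -> norm (A x) <= K * B_norm p * norm x.
Proof.
  intros (a & <- & <-).
  apply Rle_trans with (op_norm (poly_op n a T) * norm x).
  - exact (norm_le_op_norm (poly_op n a T) x (is_linear_poly_apply T hT n a)).
  - apply Rmult_le_compat_r; [apply norm_ge_0|apply hP].
Qed.

Lemma norm_iter_le (n : nat) (x : X) : norm (Nat.iter n T x) <= 2 * K * norm x.
Proof.
  rewrite <- (geom_op_0 T).
  eapply Rle_trans;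
    [exact (norm_poly_calculus_le n (geom 0 n) _ x (poly_calculus_geom T hT 0 n))|].
  apply Rmult_le_compat_r; [apply norm_ge_0|].
  pose proof (B_norm_geom_0_le n); nra.
Qed.

(** Outside the spectrum, which is a negated existence, an inverse is recovered classically. Its
    left inverse law gives the uniqueness that identifies it with the [iota] of [resolvent]. *)
Lemma resolvent_inverse (lam : C) :
  1 < Cmod lam ->
  is_linear (resolvent lam T) /\
  (forall x, resolvent lam T (char_op T lam x) = x) /\
  (forall x, char_op T lam (resolvent lam T x) = x).
Proof.
  intros Hlam.
  assert (H : ~ spectrum T lam) by (intros H; apply hspec in H; lra).
  apply NNPP in H; destruct H as (S & HS & Hl & Hr).
  replace (resolvent lam T) with S; [exact (conj HS (conj Hl Hr))|].
  apply functional_extensionality; intros x; symmetry.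
  apply iota_unique; [|apply Hr].
  intros y <-; symmetry; apply Hl.
Qed.

Lemma resolvent_square_sum_le (r s : R) (n : nat) (x : X) (phi : X -> C_NormedModule) :
  1 < r -> is_linear phi -> 4 * K <= r ^ S n ->
  sum_n (fun j => Cmod (phi (Nat.iter 2 (resolvent (node r s n j) T) x))) n
  <= op_norm phi * (28 * K * INR (S n) / ((r + 1) * (r - 1)) * norm x).
Proof.
  intros Hr Hphi Hn.
  set (lam := node r s n).
  set (y := fun j => resolvent (lam j) T (resolvent (lam j) T x)).
  assert (Hy : forall j, char_op T (lam j) (char_op T (lam j) (y j)) = x).
  { intros j; destruct (resolvent_inverse (lam j)) as (_ & _ & H).
    - unfold lam, node; rewrite Cmod_polar; lra.
    - unfold y; now rewrite !H. }
  set (eps := fun j => conj_phase (phi (y j))).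
  set (Y := sum_n (fun j => scal (eps j : C_AbsRing) (y j)) n : X).
  set (L := polar (r ^ S n) (INR (S n) * s)).
  set (B := pow_shift T L (S n)).
  assert (HB : is_linear B) by exact (is_linear_pow_shift T hT L (S n)).
  assert (HL : Cmod L = r ^ S n) by (apply Cmod_polar, pow_le; lra).
  assert (HBY : B (B Y) = sum_n (fun j => scal (eps j : C_AbsRing)
     (geom_op T (lam j) n (geom_op T (lam j) n x))) n).
  { unfold Y; rewrite !(linear_sum_n B) by exact HB.
    apply sum_n_ext; intros j.
    rewrite !(linear_scal B HB); f_equal.
    rewrite <- (Hy j) at 1.
    rewrite (geom_op_square T hT); unfold lam; now rewrite Cpow_node. }
  assert (Hnorm : norm (B (B Y)) <=
    K * (7 * INR (S n) * (r ^ 2) ^ S n / ((r + 1) * (r - 1))) * norm x).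
  { rewrite HBY.
    eapply Rle_trans; [exact (norm_poly_calculus_le _ _ _ x
      (poly_calculus_geom_comb T hT eps lam n))|].
    apply Rmult_le_compat_r; [apply norm_ge_0|].
    apply Rmult_le_compat_l; [lra|].
    apply B_norm_geom_comb_le; [exact Hr|intros j; apply Cmod_conj_phase_le]. }
  (* Each removal of [B] costs 2 / r^N, by ‖T^N‖ <= 2K and 4K <= r^N. The two together cancel r^{2N}
     and turn 7 into 28. *)
  assert (HY : norm Y <= 28 * K * INR (S n) / ((r + 1) * (r - 1)) * norm x).
  { pose proof (norm_pow_shift_ge T L (S n) (2 * K) Y (norm_iter_le (S n))
      ltac:(lra)) as H1.
    pose proof (norm_pow_shift_ge T L (S n) (2 * K) (B Y) (norm_iter_le (S n))
      ltac:(lra)) as H2.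
    fold B in H1, H2; rewrite HL in H1, H2.
    assert (Hp : 0 < r ^ S n) by (apply pow_lt; lra).
    apply Rmult_le_reg_l with ((r ^ S n) ^ 2); [now apply pow_lt|].
    replace ((r ^ 2) ^ S n) with ((r ^ S n) ^ 2) in Hnorm
      by (rewrite <- !pow_mult; f_equal; lia).
    apply Rle_trans with (4 * norm (B (B Y))).
    - apply (Rmult_le_compat_l (r ^ S n)) in H1; [|lra].
      lra.
    - apply (Rmult_le_compat_l 4) in Hnorm; [|lra].
      eapply Rle_trans; [exact Hnorm|right; field; lra]. }
  assert (HphiY : sum_n (fun j => Cmod (phi (y j))) n = norm (phi Y)).
  { assert (E : phi Y = RtoC (sum_n (fun j => Cmod (phi (y j))) n)).
    { unfold Y; rewrite (linear_sum_n phi _ n Hphi), sum_n_RtoC.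
      apply sum_n_ext; intros j.
      rewrite (linear_scal phi Hphi); apply conj_phase_mult. }
    rewrite E; change (norm (RtoC ?a)) with (Cmod (RtoC a)).
    rewrite Cmod_R, Rabs_pos_eq; [easy|].
    apply sum_n_ge_0; intros j; apply Cmod_ge_0. }
  change (sum_n (fun j => Cmod (phi (y j))) n
    <= op_norm phi * (28 * K * INR (S n) / ((r + 1) * (r - 1)) * norm x)).
  rewrite HphiY.
  eapply Rle_trans; [apply norm_le_op_norm, Hphi|].
  apply Rmult_le_compat_l; [now apply op_norm_ge_0|exact HY].
Qed.

(** Supplies the Riemann integrability that folding the integral relies on. *)
Lemma continuous_resolvent_square (r : R) (x : X) (phi : X -> C_NormedModule) (t : R) :
  1 < r -> is_linear phi ->
  continuous (fun t => Cmod (phi (Nat.iter 2 (resolvent (polar r t) T) x))) t.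
Proof.
  intros Hr Hphi.
  assert (Hres : forall t, 1 < Cmod (polar r t)) by (intros u; rewrite Cmod_polar; lra).
  destruct (resolvent_inverse _ (Hres t)) as (HS & HSl & _).
  destruct (linear_norm _ HS) as (M & HM & HSM).
  destruct (linear_norm _ Hphi) as (M' & HM' & HphiM).
  (* The radius 1/(2 M r) makes M |lam - mu| <= M r |t - u| <= 1/2, as the perturbation bounds
     require; [M] depends on [t]. *)
  apply continuous_of_local_lipschitz
    with (/ (2 * M * r)) (M' * (6 * M ^ 3 * r * norm x)).
  - apply Rinv_0_lt_compat; nra.
  - repeat apply Rmult_le_pos; try lra; try apply norm_ge_0; try (simpl; nra).
  - intros u Hu.
    destruct (resolvent_inverse _ (Hres u)) as (HS' & _ & HSr').
    pose proof (polar_lipschitz r t u ltac:(lra)) as Hd.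
    rewrite (Rabs_minus_sym t u) in Hd.
    assert (Hnear : M * Cmod (Cminus (polar r t) (polar r u)) <= 1 / 2).
    { apply Rle_trans with (M * (r * / (2 * M * r))).
      - apply Rmult_le_compat_l; [lra|].
        eapply Rle_trans; [exact Hd|]. apply Rmult_le_compat_l; lra.
      - right; field; lra. }
    pose proof (norm_resolvent_square_diff_le T (polar r t) (polar r u)
      (resolvent (polar r t) T) (resolvent (polar r u) T) M
      HS HM HSM HSl HS' HSr' Hnear x) as H.
    set (a := resolvent (polar r u) T (resolvent (polar r u) T x)) in *.
    set (b := resolvent (polar r t) T (resolvent (polar r t) T x)) in *.
    change (Rabs (norm (phi a) - norm (phi b)) <=
      M' * (6 * M ^ 3 * r * norm x) * Rabs (u - t)).
    eapply Rle_trans; [exact (norm_triangle_inv (phi a) (phi b))|].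
    rewrite <- (linear_minus phi a b Hphi).
    eapply Rle_trans; [apply HphiM|].
    rewrite Rmult_assoc; apply Rmult_le_compat_l; [lra|].
    eapply Rle_trans; [exact H|].
    replace (6 * M ^ 3 * r * norm x * Rabs (u - t))
      with (6 * M ^ 3 * (r * Rabs (u - t)) * norm x) by ring.
    apply Rmult_le_compat_r; [apply norm_ge_0|].
    apply Rmult_le_compat_l; [|exact Hd].
    apply Rmult_le_pos; [lra|apply pow_le; lra].
Qed.

Lemma GFS_bound (r : R) (x : X) (phi : X -> C_NormedModule) :
  1 < r -> is_linear phi ->
  RInt (fun t => Cmod (phi (Nat.iter 2 (resolvent (polar r t) T) x))) 0 (2 * PI)
  <= 56 * PI * K / ((r + 1) * (r - 1)) * norm x * op_norm phi.
Proof.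
  intros Hr Hphi.
  (* The number of nodes depends on [r], but the final bound does not contain it. *)
  destruct (Pow_x_infinity r ltac:(rewrite Rabs_pos_eq; lra) (4 * K)) as (n & Hn).
  specialize (Hn (S n) ltac:(lia)).
  rewrite Rabs_pos_eq in Hn by (apply pow_le; lra); apply Rge_le in Hn.
  assert (HN : 0 < INR (S n)) by (apply lt_0_INR; lia).
  pose proof PI_RGT_0 as Hpi.
  set (delta := 2 * PI / INR (S n)).
  replace (2 * PI) with (INR (S n) * delta) by (unfold delta; field; lra).
  eapply Rle_trans.
  - apply RInt_fold_le with
      (B := op_norm phi * (28 * K * INR (S n) / ((r + 1) * (r - 1)) * norm x)).
    + apply Rlt_le, Rdiv_lt_0_compat; lra.
    + intros t; now apply continuous_resolvent_square.
    + intros s; exact (resolvent_square_sum_le r s n x phi Hr Hphi Hn).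
  (* Here [delta * INR (S n)] is 2 PI, so the node count cancels and 28 becomes 56 PI. *)
  - right; unfold delta; field; lra.
Qed.

End CalculusToResolvent.

Theorem proposition3p3 (X : CompleteNormedModule C_AbsRing) (T : X -> X)
    (hT : is_linear T) (hspec : spectrum_in_closed_disc T)
    (hP : exists K : R, (0 < K)%R /\
       forall (n : nat) (a : nat -> C),
         (op_norm (poly_op n a T) <= K * B_norm (poly_eval n a))%R) :
  GFS_operator T.
Proof.
  destruct hP as (K & HK & HP); split; [exact hspec|].
  pose proof PI_RGT_0.
  exists (56 * PI * K); split; [nra|].
  intros r x phi Hr Hphi; simpl pow; rewrite Rmult_1_r.
  exact (GFS_bound T hT hspec K HK HP r x phi Hr Hphi).
Qed.
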